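(* For any $n\in\mathbb{Z}$ and $\overline{a}\in\mathbb{R}^{N(g_n)}$ the following first-order approximation holds: $$\Delta_n(\overline{a})=Z(g_n;\overline{a})+O\left(|\overline{a}|^2\right).$$
   Context: The Riemann–Siegel theta function is $\theta(t)=\arg\left(\Gamma\left(\frac14+\frac{it}{2}\right)\right)-\frac{t}{2}\log\pi$. For any $n\in\mathbb{Z}$, the $n$-th Gram point $g_n$ is defined as the unique solution of $\theta(g_n)=\pi n$. Put $N(g_n)=\left[\frac{|g_n|}{2}\right]$ (integer part). For $N\in\mathbb{N}$ and $\overline{a}=(a_1,\dots,a_N)\in\mathbb{R}^N$ define $$Z_N(t;\overline{a})=\cos(\theta(t))+\sum_{k=1}^{N}\frac{a_k}{\sqrt{k+1}}\cos\left(\theta(t)-\ln(k+1)\,t\right),$$ and write $Z(g_n;\overline{a})$ for $Z_{N(g_n)}(g_n;\overline{a})$. The Gram points are the extremal points of $Z_N(t;\overline{0})=\cos(\theta(t))$. Locally, around the origin $\overline{a}=\overline{0}$, $g_n(\overline{a})$ is the extremal point (in $t$) of $Z_N(t;\overline{a})$, with $N=N(g_n)$, corresponding to $g_n$, so that $g_n(\overline{0})=g_n$. The $n$-th Gram discriminant is $\Delta_n(\overline{a})=Z_{N(g_n)}(g_n(\overline{a});\overline{a})$. The first-order approximation is the first-order Taylor approximation of $\Delta_n$ at $\overline{a}=\overline{0}$. *)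

(* Defs.v *)
From mathcomp Require Import all_boot all_order all_algebra.
From mathcomp.real_closed Require Export complex.
From mathcomp Require Export all_classical all_reals all_analysis.

Set Implicit Arguments.
Unset Strict Implicit.
Unset Printing Implicit Defensive.

Import Order.TTheory GRing.Theory Num.Theory numFieldNormedType.Exports.
Local Open Scope classical_set_scope.
Local Open Scope complex_scope.
Local Open Scope ring_scope.

Definition cexp (R : realType) (z : R[i]) : R[i] :=
  (expR (complex.Re z))%:C * (cos (complex.Im z) +i* sin (complex.Im z)).

Definition natcpow (R : realType) (m : nat) (z : R[i]) : R[i] :=
  cexp (z * (ln m%:R)%:C).

(* Gamma z = lim_m m! m^z / (z (z + 1) ... (z + m)) (Euler, Gauss), the limit
   being taken in R[i]; it exists for every z outside {0, -1, -2, ...}. *)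
Definition Gamma (R : realType) (z : R[i]) : R[i] :=
  lim ((fun m : nat =>
    (m`!)%:R * natcpow m z / \prod_(k < m.+1) (z + (k : nat)%:R) : R[i]^o) @ \oo).

Definition quarter_line (R : realType) (t : R) : R[i] := (1 / 4) +i* (t / 2).

(* phi is the continuous determination of t |-> arg Gamma(1/4 + it/2); it is
   normalised by its value at t = 0, where Gamma(1/4) > 0. *)
Definition is_arg_Gamma (R : realType) (phi : R -> R) : Prop :=
  [/\ continuous phi, phi 0 = 0 &
      forall t, Gamma (quarter_line t) =
                `|Gamma (quarter_line t)| * cexp (0 +i* phi t)].

Definition arg_Gamma (R : realType) : R -> R := get (@is_arg_Gamma R).

Definition theta (R : realType) (t : R) : R := arg_Gamma t - t / 2 * ln pi.

(* theta is odd and not monotone on [-7, 7], so that for n = -1, 0, 1 the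
   equation has three solutions; each of them counts as a Gram point here. *)
Definition gram_point (R : realType) (n : int) (g : R) : Prop :=
  theta g = n%:~R * pi.

Definition gramN (R : realType) (g : R) : nat := Num.truncn (`|g| / 2).

(* The coordinate a 0 k, k = 0, ..., N - 1, is the parameter a_{k+1}. *)
Definition Zsec (R : realType) (N : nat) (t : R) (a : 'rV[R]_N) : R :=
  cos (theta t) +
  \sum_(k < N) a 0 k / Num.sqrt k.+2%:R * cos (theta t - ln k.+2%:R * t).

Definition extremal_point (R : realType) (f : R -> R) (t : R) : Prop :=
  (\forall s \near t, f s <= f t) \/ (\forall s \near t, f t <= f s).

(* gamma continues the extremal point g of cos (theta t) to parameters near 0.
   The germ of gamma at 0 is determined by these conditions. *)
Definition is_extremal_branch (R : realType) (g : R)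
    (gamma : 'rV[R]_(gramN g) -> R) : Prop :=
  [/\ gamma 0 = g, {for 0, continuous gamma} &
      \forall a \near (0 : 'rV[R]_(gramN g)),
        extremal_point (fun t => Zsec t a) (gamma a)].

Definition extremal_branch (R : realType) (g : R) : 'rV[R]_(gramN g) -> R :=
  get (@is_extremal_branch R g).

Definition gram_discriminant (R : realType) (g : R) (a : 'rV[R]_(gramN g)) : R :=
  Zsec (extremal_branch a) a.

(* Squared Euclidean norm; the library norm on 'rV is the sup norm. *)
Definition sqnorm (R : realType) (N : nat) (a : 'rV[R]_N) : R :=
  \sum_(k < N) a 0 k ^+ 2.

(* Main.v *)
Require Import Defs.
From mathcomp Require Import all_boot all_order all_algebra.
From mathcomp Require Import all_classical all_reals all_analysis.
From mathcomp Require Import ring lra zify.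
Import Order.TTheory GRing.Theory Num.Theory.
Import numFieldNormedType.Exports.
Set Implicit Arguments.
Unset Strict Implicit.
Unset Printing Implicit Defensive.
Local Open Scope classical_set_scope.
Local Open Scope ring_scope.

(** Suppose that [theta] is C^1 and that [theta' g <> 0] at the Gram point [g].
Then [cos (theta t)] has a nondegenerate extremum at [g]: its deviation from
[cos (theta g)] lies between two positive multiples of [(t - g) ^+ 2], and its
derivative is at least a multiple of [|t - g|]. The terms with coefficients
[a_k] have a [t]-derivative of size [O(|a|)]. A critical point [gamma] of the sum
that lies near [g] balances the two derivatives, so [|gamma - g| = O(|a|)]; and
passing from [g] to [gamma] changes the unperturbed part by [O((gamma - g)^2)]
and the perturbation by [O(|a| |gamma - g|)]. Both are [O(|a|^2)]. This is
[branch_value_quadratic]. A branch of extremal points exists because the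
perturbed function, with the sign that makes [g] a maximum, attains its maximum
on a small segment around [g] at an interior point
([exists_perturbed_extremum], [exists_extremal_branch]).

Regularity of [theta]. In Gauss' limit for [Gamma (1/4 + it/2)], write the
[m]-th term as [exp (modulus_seq m t + i * arg_seq m t)]. With
[node k = 2 k + 1/2],

  [arg_seq m t = t/2 * ln m - \sum_(k <= m) atan (t / node k)].

Consecutive terms of both sequences differ by [O(1/m^2)], so they converge, and
[arg_lim] is a continuous argument of [Gamma] on the line. A continuous argument
that vanishes at [0] is unique, whence [arg_GammaE]. The derivatives
[darg_seq m] converge pointwise and are Lipschitz with a constant independent of
[m], which passes differentiability to the limit ([derive_limit],
[arg_lim_C1]).

Nonvanishing of [theta'] at Gram points ([gram_point_dtheta_neq0]). [theta] is
odd, and [theta'] is even and nondecreasing on the nonnegative half line.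
Comparing the sum in [darg_seq] with the midpoint rule for the integral of
[b / (b^2 + t^2)] shows that a zero [t0 >= 0] of [theta'] lies between [31/5] and
[3 pi] ([dtheta_lt0], [dtheta_gt0]). The logarithms cancel in
[theta t - t * theta' t], which leaves

  [theta t0 = - \sum_k h (t0 / node k)],  [h x = atan x - x / (1 + x^2)],

with [h] nonnegative and increasing. Six terms of the series at [31/5] already
exceed [pi], and comparison with an integral bounds the series by
[pi/2 + t0/2 < 2 pi]. So [- 2 pi < theta t0 < - pi], and [theta t0] is not a
multiple of [pi]. *)

(** * Calculus: mean values, arctangent, logarithm *)

Section Calculus.
Variable R : realType.
Implicit Types (f g : R -> R) (a b c t x y : R).

Lemma is_derive_cont f (df : R) t : is_derive t 1 f df -> {for t, continuous f}.
Proof. by move=> h; apply/differentiable_continuous/derivable1_diffP. Qed.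

Lemma MVT_le f (df : R -> R) a b : a <= b ->
  (forall t, a <= t <= b -> is_derive t (1 : R) f (df t)) ->
  exists2 c, a <= c <= b & f b - f a = df c * (b - a).
Proof.
move=> ab fd.
have [|| c cab e] := @MVT_segment R f df a b ab.
- by move=> t; rewrite in_itv/= => /andP[h1 h2]; apply: fd; rewrite !ltW.
- apply: continuous_in_subspaceT => t /set_mem/=; rewrite in_itv/= => h.
  exact: is_derive_cont (fd t h).
- by exists c => //; rewrite in_itv/= in cab.
Qed.

Lemma MVT_dist f (df : R -> R) x y :
  (forall t, is_derive t (1 : R) f (df t)) ->
  exists2 c, `|c - x| <= `|y - x| & f y - f x = df c * (y - x).
Proof.
move=> fd; have [xy|/ltW yx] := leP x y.
  have [c /andP[h1 h2] e] := MVT_le xy (fun t _ => fd t).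
  by exists c => //; rewrite !ger0_norm ?subr_ge0// lerD2r.
have [c /andP[h1 h2] e] := MVT_le yx (fun t _ => fd t).
exists c; first by rewrite !ler0_norm ?subr_le0// lerN2 lerD2r.
by rewrite -opprB e -mulrN opprB.
Qed.

Lemma derive_ge0_le f (df : R -> R) a b : a <= b ->
  (forall t, a <= t <= b -> is_derive t (1 : R) f (df t)) ->
  (forall t, a <= t <= b -> 0 <= df t) -> f a <= f b.
Proof.
move=> ab fd f0; have [c cab e] := MVT_le ab fd.
by rewrite -subr_ge0 e mulr_ge0 ?subr_ge0// f0.
Qed.

Lemma is_derive_div f g (df dg : R) x : g x != 0 ->
  is_derive x (1 : R) f df -> is_derive x (1 : R) g dg ->
  is_derive x (1 : R) (fun y => f y / g y) ((df * g x - f x * dg) / g x ^+ 2).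
Proof.
move=> g0 fd gd; have gV := is_deriveV g0 gd.
apply: is_derive_eq => /=; rewrite /GRing.scale/=.
by field.
Qed.

Lemma is_derive_atan_comp f (df : R) x : is_derive x (1 : R) f df ->
  is_derive x (1 : R) (fun y => atan (f y)) (df / (1 + f x ^+ 2)).
Proof.
move=> fd; have := is_derive1_comp (is_derive1_atan (f x)) fd.
by rewrite mulrC.
Qed.

Lemma is_derive_ln_comp f (df : R) x : 0 < f x -> is_derive x (1 : R) f df ->
  is_derive x (1 : R) (fun y => ln (f y)) (df / f x).
Proof.
move=> f0 fd; have := is_derive1_comp (is_derive1_ln f0) fd.
by rewrite mulrC.
Qed.

Lemma atan_ge0 x : 0 <= x -> 0 <= atan x.
Proof. by move=> x0; rewrite -(@atan0 R) le_atan. Qed.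

(** A Pade approximant of [atan] at [0]; the derivative of the difference of the
two sides is [576 x^8 / ((1 + x^2) q^2)], [q] being the denominator. *)
Lemma atan_ge_pade x : 0 <= x ->
  x * (105 + 55 * x ^+ 2) / (105 + 90 * x ^+ 2 + 9 * x ^+ 4) <= atan x.
Proof.
move=> x0.
pose F y : R := atan y - y * (105 + 55 * y ^+ 2) / (105 + 90 * y ^+ 2 + 9 * y ^+ 4).
pose Q y : R := 105 + 90 * y ^+ 2 + 9 * y ^+ 4.
have Q0 y : 0 < Q y by rewrite /Q; nra.
suff : F 0 <= F x by rewrite /F atan0 !mul0r subr0 subr_ge0.
apply: (@derive_ge0_le F (fun y =>
  (1 + y ^+ 2)^-1 - ((105 + 165 * y ^+ 2) * Q y -
    y * (105 + 55 * y ^+ 2) * (180 * y + 36 * y ^+ 3)) / Q y ^+ 2)); first exact: x0.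
- move=> t _; rewrite /F.
  have d1 : is_derive t (1 : R) (fun y : R => y * (105 + 55 * y ^+ 2))
      (105 + 165 * t ^+ 2).
    by apply: is_derive_eq; rewrite /GRing.scale/=; ring.
  have d2 : is_derive t (1 : R) Q (180 * t + 36 * t ^+ 3).
    by rewrite /Q; apply: is_derive_eq; rewrite /GRing.scale/=; ring.
  have d3 := is_derive_div (lt0r_neq0 (Q0 t)) d1 d2.
  exact: is_derive_eq.
- move=> t _.
  have h : 0 < 1 + t ^+ 2 by nra.
  have -> : (1 + t ^+ 2)^-1 - ((105 + 165 * t ^+ 2) * Q t -
    t * (105 + 55 * t ^+ 2) * (180 * t + 36 * t ^+ 3)) / Q t ^+ 2 =
    576 * t ^+ 8 / ((1 + t ^+ 2) * Q t ^+ 2).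
    have := Q0 t; rewrite /Q => q0.
    by field; rewrite !lt0r_neq0.
  apply: divr_ge0; last by apply: mulr_ge0; [exact: ltW|exact: sqr_ge0].
  by apply: mulr_ge0; [lra|exact: exprn_even_ge0].
Qed.

Lemma pi_ge : 3137 / 1000 <= pi :> R.
Proof.
have := atan_ge_pade (@ler01 R); rewrite atan1 !expr1n => h.
suff : 3137 / 1000 / 4 <= (pi : R) / 4 by rewrite ler_pM2r// invr_gt0.
apply: le_trans h.
have -> : 105 + 90 * 1 + 9 * 1 = 204 :> R by ring.
lra.
Qed.

(** The derivative of [atan] decreases on the nonnegative half line. *)
Lemma atan_inc_le x y : 0 <= x <= y -> atan y - atan x <= (y - x) / (1 + x ^+ 2).
Proof.
move=> /andP[x0 xy].
have [c /andP[xc _] ->] := MVT_le xy (fun t _ => is_derive1_atan t).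
rewrite mulrC ler_wpM2l ?subr_ge0// lef_pV2 ?posrE; nra.
Qed.

Lemma atan_le_id x : 0 <= x -> atan x <= x.
Proof.
move=> x0; have := @atan_inc_le 0 x.
by rewrite lexx x0 atan0 !subr0 expr0n/= addr0 divr1; apply.
Qed.

(** From [atan x = pi / 2 - atan (1 / x)] and [atan u <= u]; sharp for large [x],
where [atan_ge_pade] is useless. *)
Lemma atan_ge_pihalfBV x : 0 < x -> pi / 2 - x^-1 <= atan x.
Proof.
move=> x0.
suff -> : atan x = pi / 2 - atan x^-1.
  by rewrite lerD2l lerN2 atan_le_id// invr_ge0 ltW.
have dF t : 0 < t -> is_derive t (1 : R) (fun y : R => atan y + atan (1 / y)) 0.
  move=> t0.
  have d1 := @is_derive_div (cst 1) id 0 1 t (lt0r_neq0 t0)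
    (is_derive_cst _ _ _) (is_derive_id _ _).
  have d2 := is_derive_atan_comp d1.
  apply: is_derive_eq; rewrite /cst/=; field.
  by rewrite !lt0r_neq0//; nra.
have E : atan x + atan (1 / x) = pi / 2.
  transitivity (atan 1 + atan (1 / 1) : R); last by rewrite divr1 atan1; field.
  have [x1|/ltW x1] := leP x 1.
    have [|c _ e] := @MVT_le (fun y => atan y + atan (1 / y)) (cst 0) x 1 x1.
      by move=> t /andP[xt _]; apply: dF; apply: lt_le_trans xt.
    by move: e; rewrite /cst/= mul0r => /eqP; rewrite subr_eq0 => /eqP <-.
  have [|c _ e] := @MVT_le (fun y => atan y + atan (1 / y)) (cst 0) 1 x x1.
    by move=> t /andP[xt _]; apply: dF; apply: lt_le_trans xt.
  by move: e; rewrite /cst/= mul0r => /eqP; rewrite subr_eq0 => /eqP <-.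
by move: E; rewrite div1r => <-; rewrite addrK.
Qed.

Lemma ln_ge_1BV x : 0 < x -> 1 - x^-1 <= ln x.
Proof.
move=> x0; have := @le_ln1Dx R (x^-1 - 1).
rewrite addrCA subrr addr0 lnV ?posrE// => h.
have: - ln x <= x^-1 - 1 by apply: h; rewrite ltrBrDl subrr invr_gt0.
lra.
Qed.

(** [2 x] is the first term of the power series of [ln ((1 + x) / (1 - x))], all
of whose coefficients are nonnegative. *)
Lemma ln_ratio_ge x : 0 <= x < 1 -> 2 * x <= ln (1 + x) - ln (1 - x).
Proof.
move=> /andP[x0 x1].
pose F y : R := ln (1 + y) - ln (1 - y) - 2 * y.
suff : F 0 <= F x by rewrite /F addr0 subr0 subrr !mulr0 subr0; lra.
apply: (@derive_ge0_le F (fun y => (1 + y)^-1 + (1 - y)^-1 - 2)); first exact: x0.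
- move=> t /andP[t0 tx]; rewrite /F.
  have d1 : is_derive t (1 : R) (fun y : R => ln (1 + y)) (1 / (1 + t)).
    apply: is_derive_ln_comp; first lra.
    by apply: is_derive_eq; ring.
  have d2 : is_derive t (1 : R) (fun y : R => ln (1 - y)) (- 1 / (1 - t)).
    apply: is_derive_ln_comp; first lra.
    by apply: is_derive_eq; ring.
  by apply: is_derive_eq; rewrite /GRing.scale/=; field; rewrite !lt0r_neq0; lra.
- move=> t /andP[t0 tx].
  have -> : (1 + t)^-1 + (1 - t)^-1 - 2 = 2 * t ^+ 2 / ((1 + t) * (1 - t)).
    by field; rewrite !lt0r_neq0; lra.
  by rewrite divr_ge0 ?mulr_ge0//; nra.
Qed.

(** The power series is [2 (x + x^3 / 3 + x^5 / 5 + ...)]; replacing every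
coefficient after the first by [1 / 3] gives the geometric series on the right. *)
Lemma ln_ratio_le x : 0 <= x < 1 ->
  ln (1 + x) - ln (1 - x) <= 2 * x + 2 / 3 * (x ^+ 3 / (1 - x ^+ 2)).
Proof.
move=> /andP[x0 x1].
pose F y : R := 2 * y + 2 / 3 * (y ^+ 3 / (1 - y ^+ 2)) - (ln (1 + y) - ln (1 - y)).
suff : F 0 <= F x.
  by rewrite /F addr0 subr0 subrr mulr0 !expr0n/= mul0r mulr0; lra.
apply: (@derive_ge0_le F (fun y => 2 + 2 / 3 * ((3 * y ^+ 2 - y ^+ 4) / (1 - y ^+ 2) ^+ 2)
   - ((1 + y)^-1 + (1 - y)^-1))); first exact: x0.
- move=> t /andP[t0 tx]; rewrite /F.
  have d1 : is_derive t (1 : R) (fun y : R => ln (1 + y)) (1 / (1 + t)).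
    apply: is_derive_ln_comp; first lra.
    by apply: is_derive_eq; ring.
  have d2 : is_derive t (1 : R) (fun y : R => ln (1 - y)) (- 1 / (1 - t)).
    apply: is_derive_ln_comp; first lra.
    by apply: is_derive_eq; ring.
  have q0 : 1 - t ^+ 2 != 0 by rewrite lt0r_neq0//; nra.
  have d3 : is_derive t (1 : R) (fun y : R => y ^+ 3 / (1 - y ^+ 2))
     ((3 * t ^+ 2 * (1 - t ^+ 2) - t ^+ 3 * (- (2 * t))) / (1 - t ^+ 2) ^+ 2).
    apply: is_derive_div => //; apply: is_derive_eq;
    by rewrite /GRing.scale/=; ring.
  by apply: is_derive_eq; rewrite /GRing.scale/=; field; rewrite q0 !lt0r_neq0; lra.
- move=> t /andP[t0 tx].
  have q0 : 0 < 1 - t ^+ 2 by nra.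
  have -> : 2 + 2 / 3 * ((3 * t ^+ 2 - t ^+ 4) / (1 - t ^+ 2) ^+ 2)
   - ((1 + t)^-1 + (1 - t)^-1) = 4 / 3 * t ^+ 4 / (1 - t ^+ 2) ^+ 2.
    by field; rewrite !lt0r_neq0//; lra.
  by rewrite divr_ge0 ?mulr_ge0 ?exprn_even_ge0//; lra.
Qed.

End Calculus.

(** * Passing to the limit in a sequence of functions *)

Section Limits.
Variable R : realType.

(** [C / (m (m + 1))] telescopes to [C / m], so [u m + C / m] is nonincreasing,
[u m - C / m] is nondecreasing, and the first is bounded below by the second. *)
Lemma cvg_of_incr (u : R^nat) (C : R) : 0 <= C ->
  (forall m, (0 < m)%N -> `|u m.+1 - u m| <= C / (m%:R * (m%:R + 1))) -> cvgn u.
Proof.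
move=> C0 hu.
pose c (m : nat) : R := C / m.+1%:R.
have c0 m : 0 <= c m by rewrite divr_ge0.
have hc m : C / (m.+1%:R * (m.+1%:R + 1)) = c m - c m.+1.
  by rewrite /c (natr1 m.+1); field; rewrite !lt0r_neq0 ?ltr0n//; lra.
have hu' m : `|u m.+2 - u m.+1| <= c m - c m.+1 by rewrite -hc hu.
pose v m := u m.+1 + c m.
have vdecr : nonincreasing_seq v.
  apply/nonincreasing_seqP => m; rewrite /v.
  by have := hu' m; rewrite ler_norml => /andP[]; lra.
have wincr : nondecreasing_seq (fun m => u m.+1 - c m).
  apply/nondecreasing_seqP => m.
  by have := hu' m; rewrite ler_norml => /andP[]; lra.
have vcvg : cvgn v.
  apply: nonincreasing_is_cvgn => //; exists (u 1%N - c 0%N) => _ [m _ <-].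
  have := wincr 0%N m (leq0n _); rewrite /v => /le_trans; apply.
  by have := c0 m; lra.
have ccvg : c @ \oo --> (0 : R).
  by rewrite -[X in _ --> X](mulr0 C); exact: cvgM (cvg_cst C) (@cvg_harmonic R).
have : v m - c m @[m --> \oo] --> limn v - 0 by apply: cvgB.
rewrite subr0 => h; apply/cvg_ex; exists (limn v).
rewrite -cvg_shiftS; apply: cvg_trans h.
apply: near_eq_cvg; apply: nearW => m /=.
by rewrite /v addrK.
Qed.

(** The mean value theorem and the uniform Lipschitz bound give
[|F m s - F m t - D m t (s - t)| <= L (s - t)^2] for every [m]; this inequality
passes to the pointwise limits and says that [f] has derivative [d t] at [t]. *)
Lemma derive_limit (F D : nat -> R -> R) (f d : R -> R) (L : R) : 0 < L ->
  (forall m t, is_derive t (1 : R) (F m) (D m t)) ->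
  (forall m s t, `|D m s - D m t| <= L * `|s - t|) ->
  (forall t, F m t @[m --> \oo] --> f t) ->
  (forall t, D m t @[m --> \oo] --> d t) ->
  (forall t, is_derive t (1 : R) f (d t)) /\
  (forall s t, `|d s - d t| <= L * `|s - t|).
Proof.
move=> L0 FD DL Ff Dd; split=> [t|s t]; last first.
  have h : `|D m s - D m t| @[m --> \oo] --> `|d s - d t|.
    by apply: cvg_norm; apply: cvgB.
  apply: (ler_cvg_to h (cvg_cst (L * `|s - t|))); exact: nearW.
have est s : `|f s - f t - d t * (s - t)| <= L * `|s - t| * `|s - t|.
  have h : `|F m s - F m t - D m t * (s - t)| @[m --> \oo] -->
      `|f s - f t - d t * (s - t)|.
    by apply: cvg_norm; apply: cvgB; [exact: cvgB|exact: cvgMr_tmp].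
  apply: (ler_cvg_to h (cvg_cst (L * `|s - t| * `|s - t|))).
  apply: nearW => m; have [c hc ->] := @MVT_dist R (F m) (D m) t s (FD m).
  rewrite -mulrBl normrM ler_wpM2r//; apply: le_trans (DL _ _ _) _.
  by rewrite ler_wpM2l// ltW.
pose g s := if s == t then d t else (f s - f t) / (s - t).
apply/is_derive1_caratheodory; exists g; split.
- move=> s; rewrite /g; case: eqP => [->|/eqP]; first by rewrite !subrr mulr0.
  by rewrite -subr_eq0 => /divfK->.
- have gt : g t = d t by rewrite /g eqxx.
  apply/cvgrPdist_le => e e0; rewrite gt; near=> s.
  apply: (@le_trans _ _ (L * `|t - s|)).
    rewrite /g; case: eqP => [->|/eqP st]; first by rewrite !subrr normr0 mulr0.
    have st0 : 0 < `|s - t| by rewrite normr_gt0 subr_eq0.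
    rewrite -(ler_pM2r st0) -normrM mulrBl divfK ?subr_eq0//.
    by rewrite distrC (distrC t s).
  rewrite -ler_pdivlMl//; near: s.
  by apply: cvgr_dist_le => //; rewrite mulr_gt0 ?invr_gt0.
- by rewrite /g eqxx.
Unshelve. all: by end_near. Qed.

End Limits.

(** * The argument of the Gauss product *)

Section ArgSeq.
Variable R : realType.
Implicit Types (t x : R) (m k : nat).

(** Twice the real part of the [k]-th factor [1/4 + k + it/2] of the Gamma product;
the argument of that factor is [atan (t / node k)]. *)
Definition node k : R := 2 * k%:R + 1 / 2.

Lemma node_gt0 k : 0 < node k.
Proof. by rewrite ltr_wpDl// ?mulr_ge0//; lra. Qed.

Lemma nodeS k : node k.+1 = node k + 2.
Proof. by rewrite /node -(natr1 k); ring. Qed.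

Definition arg_seq m t : R := t / 2 * ln m%:R - \sum_(k < m.+1) atan (t / node k).

Definition darg_seq m t : R :=
  ln m%:R / 2 - \sum_(k < m.+1) node k / (node k ^+ 2 + t ^+ 2).

Lemma is_derive_arg_seq m t : is_derive t (1 : R) (arg_seq m) (darg_seq m t).
Proof.
have ds : is_derive t (1 : R) (fun y => \sum_(k < m.+1) atan (y / node k))
    (\sum_(k < m.+1) node k / (node k ^+ 2 + t ^+ 2)).
  have := @is_derive_sum _ _ _ m.+1 (fun (k : 'I_m.+1) (y : R) => atan (y / node k))
    t 1 (fun k : 'I_m.+1 => node k / (node k ^+ 2 + t ^+ 2)).
  rewrite fct_sumE; apply => k; have n0 := node_gt0 k.
  have d1 : is_derive t (1 : R) (fun y : R => y / node k) (node k)^-1.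
    by apply: is_derive_eq; rewrite /GRing.scale/=; ring.
  apply: is_derive_eq (is_derive_atan_comp d1) _.
  by field; rewrite !lt0r_neq0//; nra.
have d2 : is_derive t (1 : R) (fun y : R => y / 2 * ln m%:R) (ln m%:R / 2).
  by apply: is_derive_eq; rewrite /GRing.scale/=; ring.
exact: is_deriveB.
Qed.

Lemma arg_seq0 m : arg_seq m 0 = 0.
Proof.
by rewrite /arg_seq !mul0r big1 ?subrr// => k _; rewrite mul0r atan0.
Qed.

(** The two rectangle bounds for the integral of [1 / u] over [x, x + 1]. *)
Lemma lnS_bounds x : 0 < x -> (x + 1)^-1 <= ln (x + 1) - ln x <= x^-1.
Proof.
move=> x0; rewrite -ln_div ?posrE; [|lra|lra].
have -> : (x + 1) / x = 1 + x^-1 by field; rewrite lt0r_neq0.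
have xV : 0 < x^-1 by rewrite invr_gt0.
apply/andP; split; last by apply: le_ln1Dx; lra.
have : 1 - (1 + x^-1)^-1 <= ln (1 + x^-1) by apply: ln_ge_1BV; lra.
suff -> : 1 - (1 + x^-1)^-1 = (x + 1)^-1 by [].
by field; rewrite !lt0r_neq0//; lra.
Qed.

Lemma darg_incr m t : (0 < m)%N ->
  `|darg_seq m.+1 t - darg_seq m t| <= (2 + t ^+ 2) / (m%:R * (m%:R + 1)).
Proof.
move=> m0; have x1 : 1 <= m%:R :> R by rewrite ler1n.
rewrite /darg_seq big_ord_recr/= /node -(natr1 m).
set S := \sum_(_ < _) _; set x := m%:R in x1 *.
have [x0 x10] : 0 < x /\ 0 < x + 1 by lra.
have /andP[h1 h2] := lnS_bounds x0.
set b := 2 * (x + 1) + 1 / 2.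
have b0 : 0 < b by rewrite /b; lra.
have q0 : 0 < b ^+ 2 + t ^+ 2 by nra.
have h3 : b / (b ^+ 2 + t ^+ 2) <= (x + 1)^-1 / 2.
  rewrite -invfM ler_pdivrMr// ler_pdivlMl; last lra.
  by rewrite /b; nra.
have h4 : x^-1 / 2 - b / (b ^+ 2 + t ^+ 2) <= (2 + t ^+ 2) / (x * (x + 1)).
  have -> : x^-1 / 2 - b / (b ^+ 2 + t ^+ 2) =
      (5 / 4) / (x * b) + t ^+ 2 / (b * (b ^+ 2 + t ^+ 2)).
    rewrite /b; field; do ?[apply/andP; split]; apply: lt0r_neq0;
    by move: q0; rewrite /b => q0; nra.
  have xx : 0 < x * (x + 1) by exact: mulr_gt0.
  rewrite [leRHS]mulrDl; apply: lerD.
    apply: ler_pM; rewrite ?invr_ge0; [lra| |lra|]; first by rewrite mulr_ge0// ltW.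
    by rewrite lef_pV2 ?posrE ?mulr_gt0// ler_pM2l// /b; lra.
  rewrite ler_wpM2l ?sqr_ge0// lef_pV2 ?posrE ?mulr_gt0//.
  have xb : x + 1 <= b by rewrite /b; lra.
  have bb : b * 1 <= b ^+ 2 by rewrite expr2 ler_pM2l//; lra.
  have tt := sqr_ge0 t.
  have : x * (x + 1) <= b * b by apply: ler_pM; lra.
  move/le_trans; apply; rewrite ler_pM2l//; lra.
rewrite ler_norml; apply/andP; split; last by lra.
have : 0 <= (2 + t ^+ 2) / (x * (x + 1)).
  by apply: divr_ge0; [have := sqr_ge0 t; lra|rewrite mulr_ge0// ltW].
lra.
Qed.

(** Both [arg_seq] vanish at [0], so the bound [darg_incr] on the derivatives can
be integrated. *)
Lemma arg_incr m t : (0 < m)%N ->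
  `|arg_seq m.+1 t - arg_seq m t| <= `|t| * (2 + t ^+ 2) / (m%:R * (m%:R + 1)).
Proof.
move=> m0.
have [c hc] := @MVT_dist R (fun s => arg_seq m.+1 s - arg_seq m s)
  (fun s => darg_seq m.+1 s - darg_seq m s) 0 t
  (fun s => is_deriveB (is_derive_arg_seq m.+1 s) (is_derive_arg_seq m s)).
rewrite !arg_seq0 subrr !subr0 in hc * => ->.
rewrite normrM mulrC -mulrA ler_wpM2l//; apply: le_trans (darg_incr c m0) _.
rewrite ler_wpM2r ?invr_ge0 ?mulr_ge0 ?addr_ge0//.
rewrite lerD2l -[leRHS]real_normK ?num_real// -[leLHS]real_normK ?num_real//.
by rewrite lerXn2r ?nnegrE.
Qed.

Lemma sum_node_sqV m : \sum_(k < m.+1) (node k ^+ 2)^-1 <= 6 - (m%:R + 1)^-1.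
Proof.
elim: m => [|m IH].
  by rewrite big_ord_recr big_ord0/= /node mulr0 !add0r invr1 -exprVn invf_div divr1; lra.
rewrite big_ord_recr/=; apply: le_trans (lerD IH (lexx _)) _.
rewrite -(natr1 m); set x : R := m%:R.
have x0 : 0 <= x by exact: ler0n.
have : (node m.+1 ^+ 2)^-1 <= (x + 1)^-1 - (x + 1 + 1)^-1.
  have -> : (x + 1)^-1 - (x + 1 + 1)^-1 = ((x + 1) * (x + 1 + 1))^-1.
    by field; rewrite !lt0r_neq0//; lra.
  rewrite lef_pV2 ?posrE ?exprn_gt0 ?node_gt0// ?mulr_gt0//; [|lra|lra].
  by rewrite /node -(natr1 m) -/x; nra.
lra.
Qed.

(** Each summand [b / (b^2 + t^2)] is Lipschitz in [t] with constant [b ^- 2], and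
these constants are summable. *)
Lemma darg_seq_lip m (s t : R) : `|darg_seq m s - darg_seq m t| <= 6 * `|s - t|.
Proof.
rewrite /darg_seq; set A := \sum_(k < _) _ / (_ + s ^+ 2).
set B := \sum_(k < _) _; set l := _ / 2.
have -> : l - A - (l - B) = B - A by ring.
rewrite -sumrB.
apply: le_trans (ler_norm_sum _ _ _) _.
apply: (@le_trans _ _ (\sum_(k < m.+1) (node k ^+ 2)^-1 * `|s - t|)); last first.
  rewrite -mulr_suml ler_wpM2r//; apply: le_trans (sum_node_sqV m) _.
  by rewrite lerBlDr lerDl invr_ge0 addr_ge0.
apply: ler_sum => k _; have := node_gt0 k; set b := node k => b0.
have qs : 0 < b ^+ 2 + s ^+ 2 by nra.
have qt : 0 < b ^+ 2 + t ^+ 2 by nra.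
have -> : b / (b ^+ 2 + t ^+ 2) - b / (b ^+ 2 + s ^+ 2) =
  (b * (s + t)) / ((b ^+ 2 + t ^+ 2) * (b ^+ 2 + s ^+ 2)) * (s - t).
  by field; rewrite !lt0r_neq0.
rewrite normrM ler_wpM2r// normrM normfV (ger0_norm (mulr_ge0 (ltW qt) (ltW qs))).
rewrite ler_pdivrMr ?mulr_gt0// ler_pdivlMl ?exprn_gt0//.
rewrite normrM gtr0_norm//.
apply: (@le_trans _ _ (b ^+ 2 * (b * (`|s| + `|t|)))).
  apply: ler_wpM2l; first exact: sqr_ge0.
  by apply: ler_wpM2l; [exact: ltW|exact: ler_normD].
rewrite -(real_normK (num_real s)) -(real_normK (num_real t)).
set u := `|s|; set v := `|t|.
have u0 : 0 <= u by exact: normr_ge0.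
have v0 : 0 <= v by exact: normr_ge0.
have hu : 2 * (b * u) <= b ^+ 2 + u ^+ 2 by have := sqr_ge0 (b - u); lra.
have hv : 2 * (b * v) <= b ^+ 2 + v ^+ 2 by have := sqr_ge0 (b - v); lra.
have b2 : b ^+ 2 <= b ^+ 2 + u ^+ 2 by have := sqr_ge0 u; lra.
have b2' : b ^+ 2 <= b ^+ 2 + v ^+ 2 by have := sqr_ge0 v; lra.
have k1 : b ^+ 2 * (2 * (b * v)) <= (b ^+ 2 + u ^+ 2) * (b ^+ 2 + v ^+ 2).
  by apply: ler_pM => //; [exact: sqr_ge0|nra].
have k2 : 2 * (b * u) * b ^+ 2 <= (b ^+ 2 + u ^+ 2) * (b ^+ 2 + v ^+ 2).
  by apply: ler_pM => //; [nra|exact: sqr_ge0].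
lra.
Qed.

Definition arg_lim t : R := limn (arg_seq ^~ t).
Definition darg_lim t : R := limn (darg_seq ^~ t).

Lemma cvg_arg_seq t : arg_seq m t @[m --> \oo] --> arg_lim t.
Proof.
apply: (@cvg_of_incr R (arg_seq ^~ t) (`|t| * (2 + t ^+ 2))).
  by rewrite mulr_ge0// addr_ge0// sqr_ge0.
by move=> m; exact: arg_incr.
Qed.

Lemma cvg_darg_seq t : darg_seq m t @[m --> \oo] --> darg_lim t.
Proof.
apply: (@cvg_of_incr R (darg_seq ^~ t) (2 + t ^+ 2)).
  by rewrite addr_ge0// sqr_ge0.
by move=> m; exact: darg_incr.
Qed.

Lemma arg_lim_C1 : (forall t, is_derive t (1 : R) arg_lim (darg_lim t)) /\
  (forall s t, `|darg_lim s - darg_lim t| <= 6 * `|s - t|).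
Proof.
apply: (@derive_limit R arg_seq darg_seq) => //.
- exact: is_derive_arg_seq.
- exact: darg_seq_lip.
- exact: cvg_arg_seq.
- exact: cvg_darg_seq.
Qed.

Lemma arg_lim0 : arg_lim 0 = 0.
Proof.
apply: cvg_lim => //; under eq_fun do rewrite arg_seq0; exact: cvg_cst.
Qed.

End ArgSeq.

(** * The argument of Gamma on the quarter line *)

Section GammaArg.
Local Open Scope complex_scope.
Variable R : realType.
Implicit Types (t x y : R) (z w : R[i]).

Lemma complex_eqP (z w : R[i]) :
  complex.Re z = complex.Re w -> complex.Im z = complex.Im w -> z = w.
Proof. by case: z w => [a b] [c d] /= -> ->. Qed.

Lemma ReD z w : complex.Re (z + w) = complex.Re z + complex.Re w.
Proof. by case: z w => [a b] [c d]. Qed.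

Lemma ImD z w : complex.Im (z + w) = complex.Im z + complex.Im w.
Proof. by case: z w => [a b] [c d]. Qed.

Lemma complexMR (a b c : R) : (a +i* b) * c%:C = (a * c) +i* (b * c).
Proof. by apply: complex_eqP => /=; ring. Qed.

Lemma cexpE x y : cexp (x +i* y) = (expR x * cos y) +i* (expR x * sin y).
Proof. by rewrite /cexp/=; apply: complex_eqP => /=; ring. Qed.

Lemma cexpD z w : cexp (z + w) = cexp z * cexp w.
Proof.
case: z w => [a b] [c d]; have -> : (a +i* b) + (c +i* d) = (a + c) +i* (b + d) by [].
rewrite !cexpE expRD cosD sinD.
by apply: complex_eqP => /=; ring.
Qed.

Lemma cexp0 : cexp (0 : R[i]) = 1.
Proof. by rewrite cexpE expR0 cos0 sin0 !mul1r. Qed.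

Lemma cexpN z : cexp (- z) = (cexp z)^-1.
Proof.
have h : cexp (- z) * cexp z = 1 by rewrite -cexpD addNr cexp0.
have h0 : cexp z != 0.
  by apply/eqP => e; move: h; rewrite e mulr0 => /eqP; rewrite eq_sym oner_eq0.
by apply: (mulIf h0); rewrite h mulVf.
Qed.

Lemma cexp_real x : cexp x%:C = (expR x)%:C.
Proof. by rewrite cexpE cos0 sin0 mulr1 mulr0. Qed.

Lemma norm_cexp x y : `|cexp (x +i* y)| = (expR x)%:C.
Proof.
rewrite normc_def cexpE/= !exprMn -mulrDr cos2Dsin2 mulr1 sqrtr_sqr.
by rewrite gtr0_norm ?expR_gt0.
Qed.

Lemma complex_polar x y : 0 < x ->
  x +i* y = cexp (ln (x ^+ 2 + y ^+ 2) / 2 +i* atan (y / x)).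
Proof.
move=> x0; set u := y / x.
have yE : y = x * u by rewrite /u; field; rewrite lt0r_neq0.
have h : 0 < 1 + u ^+ 2 by nra.
have c0 : 0 < Num.sqrt (1 + u ^+ 2) by rewrite sqrtr_gt0.
have cN : cos (atan u) != 0 by rewrite cos_atan invr_neq0// lt0r_neq0.
have e : x * Num.sqrt (1 + u ^+ 2) = expR (ln (x ^+ 2 + y ^+ 2) / 2).
  have -> : x ^+ 2 + y ^+ 2 = (x * Num.sqrt (1 + u ^+ 2)) ^+ 2.
    by rewrite exprMn sqr_sqrtr ?ltW// yE; ring.
  rewrite lnXn; last exact: mulr_gt0.
  have -> (z : R) : z *+ 2 / 2 = z by rewrite mulr2n; field.
  by rewrite lnK// posrE mulr_gt0.
have hs : sin (atan u) = u * cos (atan u).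
  have tu : sin (atan u) / cos (atan u) = u by rewrite -[RHS](atanK u).
  by rewrite -[X in _ = X * _]tu divfK.
rewrite cexpE -e hs cos_atan; apply: complex_eqP => /=.
  by rewrite mulfK// lt0r_neq0.
by rewrite {1}yE; field; rewrite lt0r_neq0.
Qed.

Definition modulus_seq m t : R :=
  \sum_(k < m) ln k.+1%:R + ln m%:R / 4
  - \sum_(k < m.+1) ln ((node R k / 2) ^+ 2 + (t / 2) ^+ 2) / 2.

(** [cexp] turns the quotient of products into a difference of sums, each factor
[1/4 + k + it/2] being written in polar form by [complex_polar]. *)
Lemma Gamma_term m t :
  (m`!)%:R * natcpow m (quarter_line t) /
    \prod_(k < m.+1) (quarter_line t + (k : nat)%:R) =
  cexp (modulus_seq m t +i* arg_seq m t).
Proof.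
have E1 : (m`!)%:R = cexp ((\sum_(k < m) ln k.+1%:R) +i* (0 : R)).
  elim: m => [|m IH]; first by rewrite big_ord0 cexp0.
  rewrite big_ord_recr/= factS natrM mulrC IH.
  have -> : m.+1%:R = cexp (ln (m.+1%:R : R))%:C.
    by rewrite cexp_real lnK ?posrE// rmorph_nat.
  by rewrite -cexpD; congr cexp; apply: complex_eqP => /=; ring.
have E2 n : (\prod_(k < n) (quarter_line t + (k : nat)%:R))^-1 =
  cexp (- (\sum_(k < n) ln ((node R k / 2) ^+ 2 + (t / 2) ^+ 2) / 2)
    +i* - (\sum_(k < n) atan (t / node R k))).
  elim: n => [|n IH]; first by rewrite !big_ord0 oppr0 cexp0 invr1.
  rewrite !big_ord_recr/= invfM IH.
  have n0 := node_gt0 R n.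
  have -> : quarter_line t + n%:R = (node R n / 2) +i* (t / 2).
    rewrite /quarter_line -(rmorph_nat (real_complex R)).
    by apply: complex_eqP => /=; rewrite /node; field.
  rewrite (@complex_polar (node R n / 2)) ?divr_gt0//.
  rewrite -cexpN -cexpD; congr cexp; apply: complex_eqP => /=; first ring.
  have -> : t / 2 / (node R n / 2) = t / node R n by field; rewrite lt0r_neq0.
  ring.
rewrite E1 E2 /natcpow -!cexpD /quarter_line complexMR.
by congr cexp; apply: complex_eqP; rewrite ?ReD ?ImD/= /modulus_seq /arg_seq; field.
Qed.

(** With [x = m], the increment is
[ln (1 + 1 / x) / 4 - ln (q / (x + 1)^2) / 2] where
[q = (x + 5/4)^2 + t^2 / 4], and both terms are [1 / (4 x) + O(1 / x^2)]. *)
Lemma modulus_incr m t : (0 < m)%N ->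
  `|modulus_seq m.+1 t - modulus_seq m t| <= (2 + t ^+ 2) / (m%:R * (m%:R + 1)).
Proof.
move=> m0; have x1 : 1 <= m%:R :> R by rewrite ler1n.
rewrite /modulus_seq !(big_ord_recr m.+1)/= (big_ord_recr m)/=.
set S := \sum_(_ < m) _; set S' := \sum_(_ < m.+1) _.
rewrite /node -(natr1 m); set x := m%:R in x1 *.
have [x0 x10] : 0 < x /\ 0 < x + 1 by lra.
have /andP[h1 h2] := lnS_bounds x0.
set q := _ ^+ 2 + _.
have qE : q = (x + 1 + 1 / 4) ^+ 2 + t ^+ 2 / 4 by rewrite /q; field.
have tt := sqr_ge0 t.
have -> : S + ln (x + 1) + ln (x + 1) / 4 - (S' + ln q / 2) - (S + ln x / 4 - S')
  = (ln (x + 1) - ln x) / 4 - (ln q - 2 * ln (x + 1)) / 2 by field.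
have q0 : 0 < q by rewrite qE; nra.
have -> : ln q - 2 * ln (x + 1) = ln (q / (x + 1) ^+ 2).
  by rewrite ln_div ?posrE ?exprn_gt0// lnXn//; ring.
have r0 : 0 < q / (x + 1) ^+ 2 by rewrite divr_gt0 ?exprn_gt0.
have C0 : 0 < x * (x + 1) by exact: mulr_gt0.
have k1 : ln (q / (x + 1) ^+ 2) <= q / (x + 1) ^+ 2 - 1.
  have := @le_ln1Dx R (q / (x + 1) ^+ 2 - 1).
  by rewrite [1 + _]addrC subrK; apply; lra.
have k2 : q / (x + 1) ^+ 2 - 1 = (x + 1)^-1 / 2 + (1 / 16 + t ^+ 2 / 4) / (x + 1) ^+ 2.
  by rewrite qE; field; rewrite lt0r_neq0.
have k3 : (1 / 16 + t ^+ 2 / 4) / (x + 1) ^+ 2 <= (1 / 16 + t ^+ 2 / 4) / (x * (x + 1)).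
  apply: ler_wpM2l; first lra.
  by rewrite lef_pV2 ?posrE ?exprn_gt0// expr2 ler_pM2r//; lra.
have k4 : 1 - (q / (x + 1) ^+ 2)^-1 <= ln (q / (x + 1) ^+ 2) by exact: ln_ge_1BV.
have k5 : (q / (x + 1) ^+ 2)^-1 <= 1 - (1 / 2) * (x + 1)^-1 + (1 / 4) / (x * (x + 1)).
  rewrite invf_div.
  have -> : 1 - 1 / 2 * (x + 1)^-1 + 1 / 4 / (x * (x + 1)) =
     (x * (x + 1) - x / 2 + 1 / 4) / (x * (x + 1)) by field; rewrite !lt0r_neq0.
  rewrite ler_pdivrMr// mulrAC ler_pdivlMr// qE.
  have p1 : 0 <= x * (x + 1) - x / 2 + 1 / 4 by nra.
  have : 0 <= (x * (x + 1) - x / 2 + 1 / 4) * (t ^+ 2 / 4) by rewrite mulr_ge0//; lra.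
  nra.
have Cm : 0 < (x * (x + 1))^-1 by rewrite invr_gt0.
have tC : 0 <= t ^+ 2 * (x * (x + 1))^-1 by rewrite mulr_ge0// ltW.
have hx : x^-1 = (x + 1)^-1 + (x * (x + 1))^-1 by field; rewrite !lt0r_neq0.
rewrite ler_norml; apply/andP; split; lra.
Qed.

Definition modulus_lim t : R := limn (modulus_seq ^~ t).

Lemma cvg_modulus_seq t : modulus_seq m t @[m --> \oo] --> modulus_lim t.
Proof.
apply: (@cvg_of_incr R (modulus_seq ^~ t) (2 + t ^+ 2)).
  by rewrite addr_ge0// sqr_ge0.
by move=> m; exact: modulus_incr.
Qed.

Lemma cvg_complex (u v : R^nat) (x y : R) :
  u @ \oo --> x -> v @ \oo --> y ->
  ((fun m => u m +i* v m : R[i]^o) @ \oo) --> (x +i* y : R[i]^o).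
Proof.
move=> ux vy; apply/cvgrPdist_le => e e0.
case: e e0 => a b; rewrite ltcE/= => /andP[/eqP -> a0].
have a2 : 0 < a / 2 by rewrite divr_gt0.
near=> m.
have h1 : `|x - u m| <= a / 2 by near: m; move/cvgrPdist_le: ux; apply.
have h2 : `|y - v m| <= a / 2 by near: m; move/cvgrPdist_le: vy; apply.
rewrite normc_def/= lecR.
rewrite -[leRHS]gtr0_norm// -sqrtr_sqr ler_wsqrtr//.
rewrite -(real_normK (num_real (x - u m))) -(real_normK (num_real (y - v m))).
have n1 := normr_ge0 (x - u m); have n2 := normr_ge0 (y - v m).
have -> : a ^+ 2 = 4 * ((a / 2) * (a / 2)) by field.
have k1 : `|x - u m| * `|x - u m| <= a / 2 * (a / 2) by exact: ler_pM.
have k2 : `|y - v m| * `|y - v m| <= a / 2 * (a / 2) by exact: ler_pM.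
rewrite !expr2; have := mulr_gt0 a2 a2; lra.
Unshelve. all: by end_near. Qed.

Lemma Gamma_quarter_line t :
  Gamma (quarter_line t) = cexp (modulus_lim t +i* arg_lim t).
Proof.
rewrite /Gamma; apply: (@cvg_lim (R[i]^o)); first exact: norm_hausdorff.
suff h : (fun m => cexp (modulus_seq m t +i* arg_seq m t) : R[i]^o) @ \oo -->
    (cexp (modulus_lim t +i* arg_lim t) : R[i]^o).
  by under eq_fun do rewrite Gamma_term.
rewrite cexpE.
under eq_fun do rewrite cexpE.
have ce : expR (modulus_seq m t) @[m --> \oo] --> expR (modulus_lim t).
  by apply: continuous_cvg; [exact: continuous_expR|exact: cvg_modulus_seq].
apply: cvg_complex; apply: cvgM => //; apply: continuous_cvg;
  by [exact: continuous_cos|exact: continuous_sin|exact: cvg_arg_seq].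
Qed.

Lemma continuous_arg_lim : continuous (@arg_lim R).
Proof. by move=> t; exact: is_derive_cont ((arg_lim_C1 R).1 t). Qed.

Lemma is_arg_Gamma_arg_lim : is_arg_Gamma (@arg_lim R).
Proof.
split; [exact: continuous_arg_lim|exact: arg_lim0|move=> t].
rewrite Gamma_quarter_line norm_cexp -cexp_real -cexpD; congr cexp.
by apply: complex_eqP => /=; rewrite ?addr0 ?add0r.
Qed.

(** Otherwise [|f|] would reach a positive value [v] with [cos v = 1], so [v >= pi],
and the intermediate value theorem would give a point where [|f| = pi] and
the cosine is [-1]. *)
Lemma continuous_cos1_eq0 (f : R -> R) : continuous f -> f 0 = 0 ->
  (forall t, cos (f t) = 1) -> forall t, f t = 0.
Proof.
move=> fc f0 f1 t; apply/eqP/negPn/negP => ft0.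
pose g s := Num.sg (f t) * f s.
have g0 : g 0 = 0 by rewrite /g f0 mulr0.
have gt : g t = `|f t| by rewrite /g -normrEsg.
have gc : continuous g.
  by move=> s; apply: cvgMl_tmp; exact: fc.
have gcos s : cos (g s) = 1 by rewrite /g cos_sg.
have gpi : pi <= g t.
  have [//|gtpi] := leP pi (g t).
  have : cos (g t) < cos 0.
    rewrite ltr_cos ?in_itv/= ?lexx ?pi_ge0//; first by rewrite gt normr_gt0.
    by rewrite gt normr_ge0 -gt ltW.
  by rewrite gcos cos0 ltxx.
have pi0 := pi_gt0 R.
have bound : Num.min (g 0) (g t) <= pi <= Num.max (g 0) (g t).
  rewrite g0 (min_idPl _) ?(max_idPr _) ?gpi ?ltW//; exact: lt_le_trans gpi.
have hit : exists s, g s = pi.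
  have [t0|/ltW t0] := leP 0 t.
    have [s _ ?] := IVT t0 (continuous_subspaceT gc) bound.
    by exists s.
  have [|s _ ?] := @IVT R g t 0 pi t0 (continuous_subspaceT gc).
    by rewrite minC maxC.
  by exists s.
have [s gs] := hit; have := gcos s; rewrite gs cospi; lra.
Qed.

(** [Gamma] does not vanish on the line, so two arguments differ by a continuous
function with values in the multiples of [2 pi]. *)
Lemma arg_GammaE : @arg_Gamma R = @arg_lim R.
Proof.
have : is_arg_Gamma (@arg_Gamma R).
  by apply: getI; exact: is_arg_Gamma_arg_lim.
move=> [fc f0 fG]; apply/funext => t; apply/eqP; rewrite -subr_eq0; apply/eqP.
apply: (@continuous_cos1_eq0 (fun t => arg_Gamma t - arg_lim t)).
- by move=> s; apply: cvgB; [exact: fc|exact: continuous_arg_lim].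
- by rewrite f0 arg_lim0 subrr.
move=> s.
have [_ _ /(_ s) e] := is_arg_Gamma_arg_lim; have := fG s; rewrite {1}e.
have G0 : `|Gamma (quarter_line s)| != 0.
  rewrite Gamma_quarter_line norm_cexp.
  by apply/eqP => -[] /eqP; rewrite expR_eq0.
move=> /(mulfI G0); rewrite !cexpE expR0 !mul1r => -[ec es].
by rewrite cosB ec es -!expr2 cos2Dsin2.
Qed.

End GammaArg.

(** * The derivative of theta *)

Section ThetaDerivative.
Variable R : realType.
Implicit Types (t x b : R) (m k : nat).

Definition dtheta t : R := darg_lim t - ln pi / 2.

Lemma is_derive_theta t : is_derive t (1 : R) (@theta R) (dtheta t).
Proof.
rewrite /theta arg_GammaE.
have d1 := (arg_lim_C1 R).1 t.
have d2 : is_derive t (1 : R) (fun y : R => y / 2 * ln pi) (ln pi / 2).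
  by apply: is_derive_eq; rewrite /GRing.scale/=; ring.
exact: is_deriveB.
Qed.

Lemma dtheta_lip (s t : R) : `|dtheta s - dtheta t| <= 6 * `|s - t|.
Proof.
rewrite /dtheta opprB addrA subrK; exact: (arg_lim_C1 R).2.
Qed.

Lemma thetaN t : theta (- t) = - theta t.
Proof.
rewrite /theta arg_GammaE.
have -> : arg_lim (- t) = - arg_lim t.
  apply: cvg_lim => //.
  have -> : (@arg_seq R) ^~ (- t) = (fun m => - arg_seq m t).
    apply/funext => m; rewrite /arg_seq opprB addrC mulNr mulNr; congr (_ + _).
    by rewrite -sumrN; apply: eq_bigr => k _; rewrite mulNr atanN opprK.
  by apply: cvgN; exact: cvg_arg_seq.
by ring.
Qed.

Lemma dthetaN t : dtheta (- t) = dtheta t.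
Proof.
rewrite /dtheta /darg_lim /darg_seq.
by under eq_fun do under eq_bigr do rewrite sqrrN.
Qed.

Lemma dtheta_le (s t : R) : 0 <= s <= t -> dtheta s <= dtheta t.
Proof.
move=> /andP[s0 st]; rewrite lerB// .
apply: (ler_cvg_to (@cvg_darg_seq R s) (@cvg_darg_seq R t)).
apply: nearW => m; rewrite lerB//; apply: ler_sum => k _.
have n0 := node_gt0 R k.
rewrite ler_wpM2l ?(ltW n0)// lef_pV2 ?posrE; nra.
Qed.

(** The left side is the increment over [b - 1, b + 1] of
[u |-> ln (u^2 + t^2 + 1/3)], so this is the midpoint rule for
[2 u / (u^2 + t^2)] up to the shift [1/3]. The increment is
[ln ((1 + x) / (1 - x))] with [x = 2 b / (b^2 + t^2 + 4/3)]. With this shift,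
[ln_ratio_le] reduces the claim to [q b^2 <= (q + 4/3)^2 - 4 b^2] for
[q = b^2 + t^2], which holds because [t^2 >= 4/3]. *)
Lemma node_ln_ge b t : 0 < b -> 4 / 3 <= t ^+ 2 ->
  ln ((b + 1) ^+ 2 + (t ^+ 2 + 1 / 3)) - ln ((b - 1) ^+ 2 + (t ^+ 2 + 1 / 3)) <=
  4 * (b / (b ^+ 2 + t ^+ 2)).
Proof.
move=> b0 ht; set q := b ^+ 2 + t ^+ 2.
have q0 : 0 < q by rewrite /q; nra.
set y := q + 4 / 3; have y0 : 0 < y by rewrite /y; lra.
have yb : 0 < y - 2 * b by rewrite /y /q; nra.
have yb' : 0 < y + 2 * b by lra.
pose x := 2 * b / y.
have x0 : 0 <= x by rewrite divr_ge0//; lra.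
have x1 : x < 1 by rewrite /x ltr_pdivrMr//; lra.
have -> : (b + 1) ^+ 2 + (t ^+ 2 + 1 / 3) = y + 2 * b by rewrite /y /q; field.
have -> : (b - 1) ^+ 2 + (t ^+ 2 + 1 / 3) = y - 2 * b by rewrite /y /q; field.
have -> : ln (y + 2 * b) - ln (y - 2 * b) = ln (1 + x) - ln (1 - x).
  rewrite -!ln_div ?posrE//; [|lra|lra].
  congr ln; rewrite /x; field.
  by rewrite !lt0r_neq0.
have x01 : 0 <= x < 1 by rewrite x0.
apply: le_trans (ln_ratio_le x01) _.
set p := y ^+ 2 - 4 * b ^+ 2.
have p0 : 0 < p.
  have -> : p = (y - 2 * b) * (y + 2 * b) by rewrite /p; ring.
  exact: mulr_gt0.
have pq : q * b ^+ 2 <= p.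
  have b20 := sqr_ge0 b.
  have : 0 <= (t ^+ 2 - 4 / 3) * b ^+ 2 by rewrite mulr_ge0//; lra.
  have : 0 <= t ^+ 2 * t ^+ 2 by rewrite mulr_ge0// sqr_ge0.
  have := sqr_ge0 t; rewrite /p /y /q; nra.
rewrite -subr_ge0.
have -> : 4 * (b / q) - (2 * x + 2 / 3 * (x ^+ 3 / (1 - x ^+ 2))) =
   16 / 3 * b / y * ((p - q * b ^+ 2) / (q * p)).
  rewrite /x /p /y; field.
  have -> : (q * 3 + 4) ^+ 2 + - (4 * b ^+ 2) * 9 = 9 * p by rewrite /p /y; field.
  by rewrite !lt0r_neq0//; lra.
have qp0 : 0 < q * p by exact: mulr_gt0.
by apply: mulr_ge0; apply: divr_ge0; lra.
Qed.

(** As in [node_ln_ge], with [x = 2 b / (b^2 + t^2)]: the shift [- 1] turns the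
lower bound [2 x] of [ln_ratio_ge] into exactly the right multiple of the
summand. *)
Lemma node_ln_le b t : 0 < b -> 1 < t ->
  4 * (b / (b ^+ 2 + t ^+ 2)) <=
  ln ((b + 1) ^+ 2 + (t ^+ 2 - 1)) - ln ((b - 1) ^+ 2 + (t ^+ 2 - 1)).
Proof.
move=> b0 t1; set q := b ^+ 2 + t ^+ 2.
have t2 : 0 < (t - 1) * (t + 1) by rewrite mulr_gt0//; lra.
have qb : 0 < q - 2 * b by rewrite /q; have := sqr_ge0 (b - 1); lra.
have q0 : 0 < q by lra.
pose x := 2 * b / q.
have x0 : 0 <= x by rewrite divr_ge0//; lra.
have x1 : x < 1 by rewrite /x ltr_pdivrMr//; lra.
have -> : (b + 1) ^+ 2 + (t ^+ 2 - 1) = q + 2 * b by rewrite /q; ring.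
have -> : (b - 1) ^+ 2 + (t ^+ 2 - 1) = q - 2 * b by rewrite /q; ring.
have -> : ln (q + 2 * b) - ln (q - 2 * b) = ln (1 + x) - ln (1 - x).
  rewrite -!ln_div ?posrE//; [|lra|lra|lra].
  by congr ln; rewrite /x; field; rewrite !lt0r_neq0.
have x01 : 0 <= x < 1 by rewrite x0.
apply: le_trans (ln_ratio_ge x01).
by rewrite /x; lra.
Qed.

Lemma node_last_ge m : 2 * m%:R <= node R m + 1.
Proof. rewrite /node; lra. Qed.

(** Consecutive nodes differ by [2], so the bounds [node_ln_ge] telescope. The lower
end contributes [(node 0 - 1)^2 + t^2 + 1/3 = t^2 + 7/12]. *)
Lemma darg_lim_le t : 4 / 3 <= t ^+ 2 ->
  darg_lim t <= ln (t ^+ 2 + 7 / 12) / 4 - ln 2 / 2.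
Proof.
move=> ht; set s := t ^+ 2 + 1 / 3.
have sum_ge m : (ln ((node R m + 1) ^+ 2 + s) - ln (t ^+ 2 + 7 / 12)) / 4 <=
    \sum_(k < m.+1) node R k / (node R k ^+ 2 + t ^+ 2).
  elim: m => [|m IH].
    rewrite big_ord1; have := node_ln_ge (node_gt0 R 0) ht.
    have -> : (node R 0 - 1) ^+ 2 + (t ^+ 2 + 1 / 3) = t ^+ 2 + 7 / 12.
      by rewrite /node mulr0; field.
    by rewrite -/s; lra.
  rewrite big_ord_recr/=; have := node_ln_ge (node_gt0 R m.+1) ht.
  have -> : node R m.+1 - 1 = node R m + 1 by rewrite nodeS; ring.
  by rewrite -/s; lra.
apply: (ler_cvg_to (@cvg_darg_seq R t) (cvg_cst _)); near=> m.
have m0 : 0 < m%:R :> R by rewrite ltr0n; near: m; exists 1%N.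
rewrite /darg_seq; have := sum_ge m.
have : ln ((2 * m%:R) ^+ 2) <= ln ((node R m + 1) ^+ 2 + s).
  have n1 := node_last_ge m.
  rewrite ler_ln ?posrE ?exprn_gt0 ?mulr_gt0//; last by rewrite /s; nra.
  by rewrite /s; nra.
have -> : ln ((2 * m%:R) ^+ 2) = 2 * ln 2 + 2 * ln (m%:R : R).
  by rewrite lnXn ?mulr_gt0// lnM ?posrE//; ring.
by rewrite /cst; lra.
Unshelve. all: by end_near. Qed.

(** The bounds [node_ln_le] telescope. Any constant above [4] could replace the [5]:
it serves to bound [(2 m + 3/2)^2 + t^2 - 1] by [5 m^2] for large [m]. *)
Lemma darg_lim_ge t : 1 < t -> ln ((t ^+ 2 - 3 / 4) / 5) / 4 <= darg_lim t.
Proof.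
move=> t1; set s := t ^+ 2 - 1.
have t2 : 0 < (t - 1) * (t + 1) by rewrite mulr_gt0//; lra.
have s0 : 0 < s by rewrite /s; lra.
have sum_le m : \sum_(k < m.+1) node R k / (node R k ^+ 2 + t ^+ 2) <=
   (ln ((node R m + 1) ^+ 2 + s) - ln (t ^+ 2 - 3 / 4)) / 4.
  elim: m => [|m IH].
    rewrite big_ord1; have := node_ln_le (node_gt0 R 0) t1.
    have -> : (node R 0 - 1) ^+ 2 + (t ^+ 2 - 1) = t ^+ 2 - 3 / 4.
      by rewrite /node mulr0; field.
    by rewrite -/s; lra.
  rewrite big_ord_recr/=; have := node_ln_le (node_gt0 R m.+1) t1.
  have -> : node R m.+1 - 1 = node R m + 1 by rewrite nodeS; ring.
  by rewrite -/s; lra.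
apply: (ler_cvg_to (cvg_cst _) (@cvg_darg_seq R t)); near=> m.
have ms : 9 + s <= m%:R :> R by near: m; exact: nbhs_infty_ger.
have m0 : 0 < m%:R :> R by lra.
rewrite /darg_seq; have := sum_le m.
have : ln ((node R m + 1) ^+ 2 + s) <= ln (5 * m%:R ^+ 2).
  rewrite ler_ln ?posrE ?mulr_gt0 ?exprn_gt0//; last first.
    by have := sqr_ge0 (node R m + 1); lra.
  rewrite /node; nra.
have -> : ln (5 * m%:R ^+ 2) = ln 5 + 2 * ln (m%:R : R).
  by rewrite lnM ?posrE ?exprn_gt0// lnXn//; ring.
rewrite ln_div ?posrE//; last by rewrite /s in s0; lra.
by rewrite /cst; lra.
Unshelve. all: by end_near. Qed.

(** By [darg_lim_le], [theta' t < 0] as soon as [t^2 + 7/12 < 4 pi^2]; [31/5] is a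
rational number just below [2 pi] for which the lower bound [pi_ge] is enough. *)
Lemma dtheta_lt0 : dtheta (31 / 5) < 0.
Proof.
have pi0 := pi_gt0 R; have pi1 := pi_ge R.
have := @darg_lim_le (31 / 5); rewrite /dtheta => /(_ ltac:(lra)) h.
have : ln ((31 / 5) ^+ 2 + 7 / 12) < ln ((2 * pi) ^+ 2) :> R.
  have p0 : 0 < (31 / 5) ^+ 2 + 7 / 12 :> R by lra.
  rewrite ltr_ln ?posrE ?exprn_gt0 ?mulr_gt0//.
  nra.
rewrite lnXn ?mulr_gt0// lnM ?posrE// => h2.
have : ln ((31 / 5) ^+ 2 + 7 / 12) < 2 * ln 2 + 2 * ln pi :> R by lra.
lra.
Qed.

Lemma dtheta_gt0 t : 3 * pi <= t -> 0 < dtheta t.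
Proof.
have pi0 := pi_gt0 R; have pi2 := pi_ge2 R => ht.
have t1 : 1 < t by lra.
have := darg_lim_ge t1; rewrite /dtheta => h.
have : ln (pi ^+ 2) < ln ((t ^+ 2 - 3 / 4) / 5).
  have : 3 * pi * (3 * pi) <= t * t by apply: ler_pM; lra.
  move=> tt; have pp : 0 <= (pi - 2) * pi :> R by apply: mulr_ge0; lra.
  by rewrite ltr_ln ?posrE ?exprn_gt0//; lra.
by rewrite lnXn//; lra.
Qed.

(** [theta t - t * theta' t] is minus the sum over [k] of [atan_defect (t / node k)]. *)
Definition atan_defect x : R := atan x - x / (1 + x ^+ 2).

Lemma atan_defect_le (x y : R) : 0 <= x <= y -> atan_defect x <= atan_defect y.
Proof.
move=> /andP[x0 xy].
apply: (@derive_ge0_le R atan_defect (fun u => 2 * u ^+ 2 / (1 + u ^+ 2) ^+ 2)).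
- exact: xy.
- move=> u _; have u1 : 1 + u ^+ 2 != 0 by rewrite lt0r_neq0//; nra.
  have d1 : is_derive u (1 : R) (fun y : R => y / (1 + y ^+ 2))
     ((1 * (1 + u ^+ 2) - u * (2 * u)) / (1 + u ^+ 2) ^+ 2).
    apply: is_derive_div => //.
    by apply: is_derive_eq; rewrite /GRing.scale/=; ring.
  rewrite /atan_defect; apply: is_derive_eq; field.
  exact: u1.
- move=> u _; apply: divr_ge0; last exact: sqr_ge0.
  by apply: mulr_ge0; [lra|exact: sqr_ge0].
Qed.

Lemma atan_defect_ge0 x : 0 <= x -> 0 <= atan_defect x.
Proof.
move=> x0; have := @atan_defect_le 0 x; rewrite lexx x0 /atan_defect atan0 mul0r subr0.
exact.
Qed.

Definition defect_sum m t : R := \sum_(k < m.+1) atan_defect (t / node R k).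

(** The terms [t / 2 * ln m] of [arg_seq] and of [t * darg_seq] cancel, as do the
two terms in [ln pi]. *)
Lemma cvg_defect_sum t :
  defect_sum m t @[m --> \oo] --> - (theta t - t * dtheta t).
Proof.
have -> : theta t - t * dtheta t = arg_lim t - t * darg_lim t.
  by rewrite /theta arg_GammaE /dtheta; field.
have -> : defect_sum ^~ t = fun m => - (arg_seq m t - t * darg_seq m t).
  apply/funext => m; rewrite /defect_sum /arg_seq /darg_seq.
  rewrite /atan_defect sumrB.
  have -> : \sum_(k < m.+1) t / node R k / (1 + (t / node R k) ^+ 2) =
    t * \sum_(k < m.+1) node R k / (node R k ^+ 2 + t ^+ 2).
    rewrite mulr_sumr; apply: eq_bigr => k _; have n0 := node_gt0 R k.
    field; rewrite !lt0r_neq0//; nra.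
  by field.
by apply: cvgN; apply: cvgB; [|apply: cvgMl_tmp];
  [exact: cvg_arg_seq|exact: cvg_darg_seq].
Qed.

(** The function [G b = b * atan (t / b)] is a primitive in [b] of
[atan_defect (t / b)], which decreases in [b]; hence each term after the first is
at most half the increment of [G] over the preceding step of length [2]. Moreover
[G b <= t]. *)
Lemma defect_sum_le m t : 0 < t -> defect_sum m t <= pi / 2 + t / 2.
Proof.
move=> t0.
pose G b : R := b * atan (t / b).
suff h : defect_sum m t <= pi / 2 + G (node R m) / 2.
  apply: le_trans h _; rewrite lerD2l ler_pM2r ?invr_gt0//.
  have n0 := node_gt0 R m.
  by rewrite /G mulrC -ler_pdivlMr// atan_le_id// divr_ge0// ltW.
elim: m => [|m IH].
  rewrite /defect_sum big_ord1 /G; have n0 := node_gt0 R 0.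
  have x0 : 0 <= t / node R 0 by rewrite divr_ge0// ltW.
  have := atan_ltpi2 (t / node R 0); have := atan_ge0 x0.
  have : 0 <= t / node R 0 / (1 + (t / node R 0) ^+ 2).
    by rewrite divr_ge0//; nra.
  have a0 := atan_ge0 x0; have := mulr_ge0 (ltW n0) a0.
  rewrite /atan_defect; lra.
rewrite /defect_sum big_ord_recr/= -/(defect_sum m t).
suff : atan_defect (t / node R m.+1) <= (G (node R m.+1) - G (node R m)) / 2 by lra.
rewrite nodeS; have := node_gt0 R m; set b := node R m => b0.
have b20 : 0 < b + 2 by lra.
have xy : 0 <= t / (b + 2) <= t / b.
  apply/andP; split; first by rewrite divr_ge0//; lra.
  by rewrite ler_pM2l// lef_pV2 ?posrE//; lra.
have := atan_inc_le xy; rewrite /atan_defect /G.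
set x := t / (b + 2); set y := t / b.
have x1 : 0 < 1 + x ^+ 2 by nra.
have -> : (y - x) / (1 + x ^+ 2) = (2 * (x / (1 + x ^+ 2))) / b.
  rewrite /y /x; field.
  by rewrite -/x !lt0r_neq0//; nra.
rewrite ler_pdivlMr// => h; lra.
Qed.

End ThetaDerivative.

(** * Nonvanishing of the derivative at Gram points *)

Section Nonvanishing.
Variable R : realType.
Implicit Types (t x b r : R) (m k : nat).

(** [atan_ge_pade] with denominators cleared, so that it can be checked by
arithmetic on numerals. *)
Lemma atan_defect_ge_pade x r : 0 <= x ->
  (r * (1 + x ^+ 2) + x) * (105 + 90 * x ^+ 2 + 9 * x ^+ 4) <=
    x * (105 + 55 * x ^+ 2) * (1 + x ^+ 2) -> r <= atan_defect x.
Proof.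
move=> x0; set Q := 105 + _ + _ => h.
have x1 : 0 < 1 + x ^+ 2 by nra.
have Q0 : 0 < Q by rewrite /Q; nra.
have := atan_ge_pade x0; rewrite -/Q /atan_defect.
suff : r + x / (1 + x ^+ 2) <= x * (105 + 55 * x ^+ 2) / Q by lra.
rewrite ler_pdivlMr// -(ler_pM2r x1).
suff -> : (r + x / (1 + x ^+ 2)) * Q * (1 + x ^+ 2) = (r * (1 + x ^+ 2) + x) * Q by [].
by field; rewrite lt0r_neq0.
Qed.

(** [atan_ge_pihalfBV] with denominators cleared. *)
Lemma atan_defect_ge_pihalf x r : 0 < x ->
  1 + 2 * x ^+ 2 <= r * (x * (1 + x ^+ 2)) -> pi / 2 - r <= atan_defect x.
Proof.
move=> x0 h; have x1 : 0 < 1 + x ^+ 2 by nra.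
have := atan_ge_pihalfBV x0; rewrite /atan_defect.
suff : x^-1 + x / (1 + x ^+ 2) <= r by lra.
have -> : x^-1 + x / (1 + x ^+ 2) = (1 + 2 * x ^+ 2) / (x * (1 + x ^+ 2)).
  by field; rewrite !lt0r_neq0.
by rewrite ler_pdivrMr// mulr_gt0.
Qed.

(** The nodes [1/2] and [5/2] are small compared with [t], and their terms are close
to [pi / 2] each: together they supply [pi] minus [0.9115]. The next four terms
supply at least [0.9714]. *)
Lemma defect_sum_ge m t : (5 <= m)%N -> 31 / 5 <= t -> pi + 1 / 20 <= defect_sum m t.
Proof.
move=> m5 ht; rewrite -(subnKC m5); elim: (m - 5)%N => [|j IH]; last first.
  rewrite addnS /defect_sum big_ord_recr/=; apply: le_trans IH _.
  by rewrite lerDl atan_defect_ge0// divr_ge0 ?(ltW (node_gt0 _ _))//; lra.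
have mono k x r : x * node R k = 31 / 5 -> 0 <= x -> r <= atan_defect x ->
    r <= atan_defect (t / node R k).
  move=> e x0 hr; apply: le_trans hr _; apply: atan_defect_le.
  by rewrite x0/= ler_pdivlMr ?node_gt0// e.
have h0 : pi / 2 - 161 / 1000 <= atan_defect (t / node R 0).
  apply: (@mono 0%N (62 / 5)); [by rewrite /node; lra|lra|].
  by apply: atan_defect_ge_pihalf; lra.
have h1 : pi / 2 - 7505 / 10000 <= atan_defect (t / node R 1).
  apply: (@mono 1%N (62 / 25)); [by rewrite /node; lra|lra|].
  by apply: atan_defect_ge_pihalf; lra.
have h2 : 4605 / 10000 <= atan_defect (t / node R 2).
  apply: (@mono 2%N (62 / 45)); [by rewrite /node; lra|lra|].
  by apply: atan_defect_ge_pade; lra.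
have h3 : 2615 / 10000 <= atan_defect (t / node R 3).
  apply: (@mono 3%N (62 / 65)); [by rewrite /node; lra|lra|].
  by apply: atan_defect_ge_pade; lra.
have h4 : 1539 / 10000 <= atan_defect (t / node R 4).
  apply: (@mono 4%N (62 / 85)); [by rewrite /node; lra|lra|].
  by apply: atan_defect_ge_pade; lra.
have h5 : 955 / 10000 <= atan_defect (t / node R 5).
  apply: (@mono 5%N (62 / 105)); [by rewrite /node; lra|lra|].
  by apply: atan_defect_ge_pade; lra.
rewrite /defect_sum addn0 !big_ord_recr big_ord0/=.
lra.
Qed.

(** The zero of [theta'] lies in [31/5, 3 pi], and at such a point [- theta t] is
the sum of the series of [atan_defect (t / node k)]. *)
Lemma theta_critical t : 0 <= t -> dtheta t = 0 -> - (2 * pi) < theta t < - pi.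
Proof.
move=> t0 dt0; have pi0 := pi_gt0 R; have pi2 := pi_ge2 R.
have t_lo : 31 / 5 <= t.
  rewrite leNgt; apply/negP => h.
  have : dtheta t <= dtheta (31 / 5 : R) by apply: dtheta_le; rewrite t0 ltW.
  by rewrite dt0; have := dtheta_lt0 R; lra.
have t_hi : t < 3 * pi.
  by rewrite ltNge; apply/negP => /dtheta_gt0; rewrite dt0 ltxx.
have lim := @cvg_defect_sum R t; rewrite dt0 mulr0 subr0 in lim.
have lo : pi + 1 / 20 <= - theta t.
  apply: (ler_cvg_to (cvg_cst _) lim); near=> m.
  by apply: defect_sum_ge => //; near: m; exists 5%N.
have hi : - theta t <= pi / 2 + t / 2.
  apply: (ler_cvg_to lim (cvg_cst _)); apply: nearW => m.
  by apply: defect_sum_le; lra.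
apply/andP; split; lra.
Unshelve. all: by end_near. Qed.

Lemma gram_point_dtheta_neq0 (n : int) (g : R) : gram_point n g -> dtheta g != 0.
Proof.
(* theta is odd and theta' is even. *)
suff H (k : int) (s : R) : 0 <= s -> gram_point k s -> dtheta s != 0.
  move=> hg; have [g0|/ltW g0] := leP 0 g; first exact: H hg.
  rewrite -dthetaN; apply: (H (- n)); first by rewrite oppr_ge0.
  by rewrite /gram_point thetaN hg mulrNz mulNr.
move=> s0; rewrite /gram_point => hs; apply/eqP => ds.
have := theta_critical s0 ds; rewrite hs -mulNr -(mulN1r pi).
rewrite !ltr_pM2r ?pi_gt0// => /andP[h1 h2].
have : (- 2 < k)%R by rewrite -(ltr_int R) rmorphN.
have : (k < - 1)%R by rewrite -(ltr_int R) rmorphN.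
lia.
Qed.

End Nonvanishing.

(** * Perturbation of a nondegenerate extremum *)

Section Extremal.
Variable R : realType.

(** Fermat's rule. *)
Lemma extremal_point_derive (f : R -> R) (t d : R) :
  (forall s, derivable f s (1 : R)) -> is_derive t (1 : R) f d ->
  extremal_point f t -> d = 0.
Proof.
move=> fd fdt ext.
have ball_itv (e s : R) : s \in `]t - e, t + e[%R -> `|t - s| < e.
  by rewrite in_itv/= ltr_distlC.
suff ft0 : is_derive t (1 : R) f 0 by rewrite -(@derive_val _ _ _ _ _ _ _ fdt) derive_val.
case: ext => /nbhs_normP[e /= e0 he].
- apply: (@derive1_at_max R f (t - e) (t + e) t) => [|s _||s /ball_itv /he//].
  + lra.
  + exact: fd.
  + by rewrite in_itv/=; lra.
- apply: (@derive1_at_min R f (t - e) (t + e) t) => [|s _||s /ball_itv /he//].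
  + lra.
  + exact: fd.
  + by rewrite in_itv/=; lra.
Qed.

Section Perturbation.
(** [f0] has a nondegenerate extremum at [g], a maximum when [sgn = 1] and a minimum
when [sgn = -1]; [p a] is the perturbation with parameter [a], and [amp a]
measures it. *)
Variables (V : topologicalType) (a0 : V).
Variables (f0 df0 : R -> R) (p dp : V -> R -> R) (amp : V -> R).
Variables (g delta sgn kappa K mu B : R).
Hypotheses (delta0 : 0 < delta) (sgn2 : sgn * sgn = 1) (kappa0 : 0 < kappa)
  (K0 : 0 <= K) (mu0 : 0 < mu) (B0 : 0 <= B).
Hypothesis f0_derive : forall t, is_derive t (1 : R) f0 (df0 t).
Hypothesis p_derive : forall a t, is_derive t (1 : R) (p a) (dp a t).
Hypothesis f0_extremum : forall t, `|t - g| <= delta ->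
  kappa * (t - g) ^+ 2 <= sgn * (f0 g - f0 t).
Hypothesis f0_quadratic : forall t, `|t - g| <= delta ->
  `|f0 t - f0 g| <= K * (t - g) ^+ 2.
Hypothesis df0_ge : forall t, `|t - g| <= delta -> mu * `|t - g| <= `|df0 t|.
Hypothesis dp_le : forall a t, `|t - g| <= delta -> `|dp a t| <= B * amp a.
Hypothesis amp0 : amp a0 = 0.
Hypothesis amp_ge0 : forall a, 0 <= amp a.
Hypothesis amp_cvg : amp @ a0 --> (0 : R).

Let F a t := f0 t + p a t.
Let F_derive a t : is_derive t (1 : R) (F a) (df0 t + dp a t).
Proof. exact: is_deriveD. Qed.

Lemma perturbation_lipschitz a t : `|t - g| <= delta ->
  `|p a t - p a g| <= B * amp a * `|t - g|.
Proof.
move=> ht; have [c hc ->] := MVT_dist g t (p_derive a).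
by rewrite normrM ler_wpM2r// dp_le// (le_trans hc).
Qed.

(** Let [c] maximise [sgn * F a] on the segment of radius [delta] around [g].
Comparing with the value at [g],
[kappa (c - g)^2 <= p a c - p a g <= B * amp a * |c - g|] up to sign, which bounds
[|c - g|]. When [amp a] is small this puts [c] in the open segment. *)
Lemma exists_perturbed_extremum a : B * amp a < kappa * delta ->
  exists c, `|c - g| <= B / kappa * amp a /\ extremal_point (F a) c.
Proof.
move=> small.
have le_gd : g - delta <= g + delta by have := delta0; lra.
have cont : {within `[g - delta, g + delta], continuous (fun t => sgn * F a t)}.
  apply: continuous_subspaceT => t.
  by apply: cvgMl_tmp; exact: is_derive_cont (F_derive a t).
have [c cin cmax] := EVT_max le_gd cont.
have in_dist s : (s \in `[g - delta, g + delta]%R) = (`|s - g| <= delta).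
  by rewrite in_itv/= ler_distl.
rewrite in_dist in cin.
have gc : sgn * F a g <= sgn * F a c by apply: cmax; rewrite in_dist subrr normr0 ltW.
have sgn_le x y : sgn * x - sgn * y <= `|x - y|.
  rewrite -mulrBr; apply: le_trans (ler_norm _) _; rewrite normrM.
  have -> : `|sgn| = 1; last by rewrite mul1r.
  apply/eqP; rewrite -(@eqrXn2 _ 2%N)// expr1n real_normK ?num_real//.
  by rewrite expr2 sgn2.
have dist : kappa * `|c - g| ^+ 2 <= B * amp a * `|c - g|.
  rewrite real_normK ?num_real//; apply: le_trans (f0_extremum cin) _.
  apply: le_trans (perturbation_lipschitz a cin).
  by have := sgn_le (p a c) (p a g); move: gc; rewrite /F; lra.
have cle : `|c - g| <= B / kappa * amp a.
  rewrite mulrAC ler_pdivlMr// mulrC.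
  have [->|cg] := eqVneq `|c - g| 0; first by rewrite mulr0 mulr_ge0.
  have cgp : 0 < `|c - g| by rewrite lt_def cg normr_ge0.
  by rewrite -(ler_pM2r cgp) -mulrA -expr2.
have clt : `|c - g| < delta.
  by apply: le_lt_trans cle _; rewrite mulrAC ltr_pdivrMr// (mulrC delta).
exists c; split => //.
have near_in : \forall s \near c, sgn * F a s <= sgn * F a c.
  near=> s; apply: cmax; rewrite in_dist ltW//; near: s.
  apply: (@cvgr_lt R R (nbhs c) _ (fun s => `|s - g|) `|c - g|) => //.
  by apply: cvg_norm; apply: cvgB => //; exact: cvg_cst.
have : (sgn - 1) * (sgn + 1) = 0 by rewrite -subr_sqr_1 expr2 sgn2 subrr.
move=> /eqP; rewrite mulf_eq0 subr_eq0 addr_eq0 => /orP[]/eqP e; [left|right];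
  apply: filterS near_in => s; rewrite e ?mul1r// !mulN1r lerN2//.
Unshelve. all: by end_near. Qed.

Lemma amp_near (e : R) : 0 < e -> \forall a \near a0, amp a < e.
Proof. by move=> e0; apply: (cvgr_lt _ amp_cvg). Qed.

(** Choose for every small [a] a point given by [exists_perturbed_extremum]; the
bound on its distance to [g] gives continuity at [a0] and the value [g] there. *)
Lemma exists_extremal_branch : exists gamma : V -> R,
  [/\ gamma a0 = g, {for a0, continuous gamma} &
      \forall a \near a0, extremal_point (F a) (gamma a)].
Proof.
have [gamma hgamma] := @choice V R (fun a c => B * amp a < kappa * delta ->
    `|c - g| <= B / kappa * amp a /\ extremal_point (F a) c)
  (fun a => match pselect (B * amp a < kappa * delta) with
    | left h =>
      let: ex_intro c hc := exists_perturbed_extremum h in ex_intro _ c (fun=> hc)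
    | right nh => ex_intro _ g (fun h => False_ind _ (nh h)) end).
have small : \forall a \near a0, B * amp a < kappa * delta.
  have B1 : 0 < B + 1 by have := B0; lra.
  have kd : 0 < kappa * delta by exact: mulr_gt0.
  have := @amp_near (kappa * delta / (B + 1)); rewrite divr_gt0// => /(_ isT).
  apply: filterS => a; rewrite ltr_pdivlMr// => h.
  by have := amp_ge0 a; lra.
have gamma0 : gamma a0 = g.
  have [|] := hgamma a0; first by rewrite amp0 mulr0 mulr_gt0.
  by rewrite amp0 mulr0 normr_le0 subr_eq0 => /eqP.
exists gamma; split => //.
- apply/cvgrPdist_le => e e0; rewrite gamma0.
  have C1 : 0 < B / kappa + 1 by rewrite ltr_wpDl// divr_ge0// ltW.
  near=> a.
  have [|h _] := hgamma a; first by near: a.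
  rewrite distrC; apply: le_trans h _.
  have : amp a < e / (B / kappa + 1) by near: a; apply: amp_near; rewrite divr_gt0.
  by rewrite ltr_pdivlMr// => h; have := amp_ge0 a; lra.
- by apply: filterS small => a /hgamma[].
Unshelve. all: by end_near. Qed.

(** At the critical point [gamma a] the derivatives of [f0] and [p a] are opposite,
so [mu |gamma a - g| <= B * amp a]. The variation of [f0] between [g] and
[gamma a] is then bounded by [K (B / mu)^2 amp^2], that of [p a] by
[B (B / mu) amp^2]. *)
Lemma branch_value_quadratic (gamma : V -> R) :
  gamma a0 = g -> {for a0, continuous gamma} ->
  (\forall a \near a0, extremal_point (F a) (gamma a)) ->
  \forall a \near a0, `|F a (gamma a) - F a g| <=
    (K * (B / mu) ^+ 2 + B * (B / mu)) * amp a ^+ 2.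
Proof.
move=> gamma0 gammac ext; near=> a.
have close : `|gamma a - g| <= delta.
  rewrite distrC -gamma0; near: a.
  by move/cvgrPdist_le: gammac; apply.
have crit : df0 (gamma a) + dp a (gamma a) = 0.
  apply: (extremal_point_derive _ (F_derive a (gamma a))); last by near: a.
  by move=> s; case: (F_derive a s).
have dist : `|gamma a - g| <= B / mu * amp a.
  rewrite mulrAC ler_pdivlMr// mulrC; apply: le_trans (df0_ge close) _.
  have -> : df0 (gamma a) = - dp a (gamma a) by lra.
  by rewrite normrN dp_le.
have s0 := amp_ge0 a.
have -> : F a (gamma a) - F a g =
  (f0 (gamma a) - f0 g) + (p a (gamma a) - p a g) by rewrite /F; ring.
rewrite mulrDl; apply: le_trans (ler_normD _ _) _; apply: lerD.
  apply: le_trans (f0_quadratic close) _; rewrite -mulrA ler_wpM2l//.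
  by rewrite -exprMn -real_normK ?num_real// lerXn2r ?nnegrE// (le_trans _ dist).
apply: le_trans (perturbation_lipschitz a close) _.
have -> : B * (B / mu) * amp a ^+ 2 = B * amp a * (B / mu * amp a) by ring.
by rewrite ler_wpM2l// mulr_ge0.
Unshelve. all: by end_near. Qed.

End Perturbation.
End Extremal.

(** * Elementary trigonometric estimates *)

Section Trigonometry.
Variable R : realType.
Implicit Types (x y : R).

Lemma norm_sin_le y : `|sin y| <= `|y|.
Proof.
have [c _] := MVT_dist 0 y (@is_derive_sin R).
rewrite sin0 !subr0 => ->; rewrite normrM ler_piMl//; exact: cos_max.
Qed.

Lemma oneBcosE y : 1 - cos y = 2 * sin (y / 2) ^+ 2.
Proof.
have {1}-> : y = y / 2 + y / 2 by field.
by rewrite cosD -!expr2 cos2sin2; ring.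
Qed.

Lemma oneBcos_le y : 1 - cos y <= y ^+ 2 / 2.
Proof.
rewrite oneBcosE.
have : `|sin (y / 2)| * `|sin (y / 2)| <= `|y / 2| * `|y / 2|.
  by apply: ler_pM => //; exact: norm_sin_le.
by rewrite -!normrM -!expr2 !ger0_norm ?sqr_ge0//; lra.
Qed.

(** On [-1, 1] the cosine is at least [1/2], by [oneBcos_le]. *)
Lemma norm_sin_ge y : `|y| <= 1 -> `|y| / 2 <= `|sin y|.
Proof.
move=> y1; have [c hc] := MVT_dist 0 y (@is_derive_sin R).
rewrite sin0 !subr0 in hc * => ->; rewrite normrM mulrC ler_wpM2r//.
apply: le_trans (ler_norm _); have := oneBcos_le c.
have : `|c| * `|c| <= 1 * 1 by apply: ler_pM => //; exact: le_trans hc y1.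
by rewrite -normrM -expr2 ger0_norm ?sqr_ge0//; lra.
Qed.

Lemma oneBcos_ge y : `|y| <= 1 -> y ^+ 2 / 8 <= 1 - cos y.
Proof.
move=> y1; rewrite oneBcosE.
have yE : `|y / 2| = `|y| / 2 by rewrite normrM (@ger0_norm _ 2^-1)// invr_ge0.
have y2 : `|y / 2| <= 1 by rewrite yE; have := normr_ge0 y; lra.
have h := norm_sin_ge y2.
have : `|y / 2| / 2 * (`|y / 2| / 2) <= `|sin (y / 2)| * `|sin (y / 2)|.
  by apply: ler_pM.
rewrite -normrM -expr2 (ger0_norm (sqr_ge0 _)) yE.
by rewrite -(real_normK (num_real y)); lra.
Qed.

Lemma sin_int_pi (n : int) : sin (n%:~R * pi) = 0 :> R.
Proof.
have nat_case (m : nat) : sin (m%:R * pi) = 0 :> R.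
  elim: m => [|m IH]; first by rewrite mul0r sin0.
  by rewrite -(natr1 m) mulrDl mul1r sinDpi IH oppr0.
case: n => m; first exact: nat_case.
by rewrite NegzE mulrNz mulNr sinN nat_case oppr0.
Qed.

End Trigonometry.

(** * The unperturbed function near a Gram point *)

Section NearGramPoint.
Variables (R : realType) (n : int) (g : R).
Hypothesis hg : gram_point n g.

Let c : R := `|dtheta g|.
Let sgn : R := cos (theta g).
(** The first bound keeps [theta'] within a factor between [1/2] and [3/2] of its
value at [g] ([theta'] is 6-Lipschitz); the second then keeps
[theta t - theta g] in [-1, 1], where the estimates of sine and cosine hold. *)
Definition gram_radius : R := Num.min (c / 12) (2 / (3 * c)).
Let delta : R := gram_radius.

Let c0 : 0 < c.
Proof. by rewrite normr_gt0; exact: gram_point_dtheta_neq0 hg. Qed.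

Lemma gram_radius_gt0 : 0 < gram_radius.
Proof.
rewrite lt_min !divr_gt0 ?mulr_gt0//.
Qed.

Let sin_g : sin (theta g) = 0. Proof. by rewrite hg sin_int_pi. Qed.

Lemma gram_sign : sgn * sgn = 1.
Proof. by have := cos2Dsin2 (theta g); rewrite sin_g expr0n addr0 expr2. Qed.

Lemma cos_theta_shift t : cos (theta t) = sgn * cos (theta t - theta g).
Proof.
rewrite -[in LHS](subrK (theta g) (theta t)) (cosD (theta t - theta g)).
by rewrite sin_g mulr0 subr0 mulrC.
Qed.

Lemma sin_theta_shift t : sin (theta t) = sgn * sin (theta t - theta g).
Proof.
rewrite -[in LHS](subrK (theta g) (theta t)) (sinD (theta t - theta g)).
by rewrite sin_g mulr0 addr0 mulrC.
Qed.

Lemma norm_gram_sign : `|sgn| = 1.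
Proof.
by apply/eqP; rewrite -(@eqrXn2 _ 2%N)// expr1n real_normK ?num_real// expr2 gram_sign.
Qed.

Lemma dtheta_near t : `|t - g| <= delta -> c / 2 <= `|dtheta t| <= 3 / 2 * c.
Proof.
rewrite le_min => /andP[h _]; have := dtheta_lip t g.
have h1 := ler_distD 0 (dtheta g) (dtheta t).
have := ler_dist_dist (dtheta t) (dtheta g).
rewrite -/c ler_distl => /andP[h2 h3] h4.
by apply/andP; split; lra.
Qed.

Lemma theta_near t : `|t - g| <= delta ->
  c / 2 * `|t - g| <= `|theta t - theta g| <= 3 / 2 * c * `|t - g|.
Proof.
move=> ht; have [s hs ->] := MVT_dist g t (@is_derive_theta R).
have /andP[h1 h2] := dtheta_near (le_trans hs ht).
by rewrite normrM !ler_wpM2r.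
Qed.

Lemma theta_near1 t : `|t - g| <= delta -> `|theta t - theta g| <= 1.
Proof.
move=> ht; have /andP[_ h] := theta_near ht; apply: le_trans h _.
move: ht; rewrite le_min => /andP[_].
by rewrite ler_pdivlMr ?mulr_gt0//; lra.
Qed.

(** Put [x = theta t - theta g]: then [1 - cos x >= x^2 / 8] and
[|x| >= c / 2 * |t - g|]. *)
Lemma cos_theta_extremum t : `|t - g| <= delta ->
  c ^+ 2 / 32 * (t - g) ^+ 2 <= sgn * (cos (theta g) - cos (theta t)).
Proof.
move=> ht.
have -> : sgn * (cos (theta g) - cos (theta t)) = 1 - cos (theta t - theta g).
  rewrite (cos_theta_shift t) -/sgn.
  transitivity (sgn * sgn * (1 - cos (theta t - theta g))); first by ring.
  by rewrite gram_sign mul1r.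
apply: le_trans (oneBcos_ge (theta_near1 ht)).
have /andP[h _] := theta_near ht.
rewrite -(real_normK (num_real (t - g))) -(real_normK (num_real (theta t - _))).
have cg : 0 <= c / 2 * `|t - g| by rewrite mulr_ge0// divr_ge0// ltW.
have := ler_pM cg cg h h; lra.
Qed.

Lemma cos_theta_quadratic t : `|t - g| <= delta ->
  `|cos (theta t) - cos (theta g)| <= 9 / 8 * c ^+ 2 * (t - g) ^+ 2.
Proof.
move=> ht; rewrite (cos_theta_shift t) -/sgn -{2}(mulr1 sgn) -mulrBr normrM.
rewrite norm_gram_sign mul1r distrC ger0_norm ?subr_ge0 ?cos_le1//.
apply: le_trans (oneBcos_le _) _.
have /andP[_ h] := theta_near ht.
rewrite -(real_normK (num_real (t - g))) -(real_normK (num_real (theta t - _))).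
have n0 := normr_ge0 (theta t - theta g).
have := ler_pM n0 n0 h h; lra.
Qed.

Lemma dcos_theta_ge t : `|t - g| <= delta ->
  c ^+ 2 / 8 * `|t - g| <= `|- sin (theta t) * dtheta t|.
Proof.
move=> ht; rewrite normrM normrN sin_theta_shift normrM norm_gram_sign mul1r.
have /andP[h _] := theta_near ht; have /andP[h1 _] := dtheta_near ht.
have h2 := norm_sin_ge (theta_near1 ht).
have h3 : c / 4 * `|t - g| <= `|sin (theta t - theta g)| by lra.
have a0 : 0 <= c / 4 * `|t - g| by rewrite mulr_ge0// divr_ge0// ltW.
have b0 : 0 <= c / 2 by rewrite divr_ge0// ltW.
have := ler_pM a0 b0 h3 h1; lra.
Qed.

(** * The perturbation and the expansion of the discriminant *)

Section DirichletTerms.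
Variable N : nat.
Implicit Type a : 'rV[R]_N.

Definition Zpert a (t : R) : R :=
  \sum_(k < N) a 0 k / Num.sqrt k.+2%:R * cos (theta t - ln k.+2%:R * t).

Definition dZpert a (t : R) : R :=
  \sum_(k < N) a 0 k / Num.sqrt k.+2%:R *
    (- sin (theta t - ln k.+2%:R * t) * (dtheta t - ln k.+2%:R)).

Definition l1norm a : R := \sum_(k < N) `|a 0 k|.

Lemma is_derive_cos_comp (f : R -> R) (d t : R) : is_derive t (1 : R) f d ->
  is_derive t (1 : R) (fun s => cos (f s)) (- sin (f t) * d).
Proof. by move=> fd; exact: is_derive1_comp (is_derive_cos (f t)) fd. Qed.

Lemma is_derive_Zpert a t : is_derive t (1 : R) (Zpert a) (dZpert a t).
Proof.
have := @is_derive_sum _ _ _ N (fun (k : 'I_N) (s : R) =>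
    a 0 k / Num.sqrt k.+2%:R * cos (theta s - ln k.+2%:R * s)) t 1
  (fun k : 'I_N => a 0 k / Num.sqrt k.+2%:R *
    (- sin (theta t - ln k.+2%:R * t) * (dtheta t - ln k.+2%:R))).
rewrite fct_sumE; apply => k.
have d1 : is_derive t (1 : R) (fun s : R => theta s - ln k.+2%:R * s)
    (dtheta t - ln k.+2%:R).
  have d2 : is_derive t (1 : R) (fun s : R => ln k.+2%:R * s) (ln k.+2%:R).
    by apply: is_derive_eq; rewrite /GRing.scale/=; ring.
  by apply: is_deriveB; exact: is_derive_theta.
have d3 := is_derive_cos_comp d1.
exact: is_deriveZ.
Qed.

Lemma dZpert_le a t : `|t - g| <= delta ->
  `|dZpert a t| <= (3 / 2 * c + ln N.+2%:R) * l1norm a.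
Proof.
move=> ht; have /andP[_ h] := dtheta_near ht.
rewrite /dZpert /l1norm mulr_sumr; apply: le_trans (ler_norm_sum _ _ _) _.
apply: ler_sum => k _; rewrite mulrC !normrM normfV.
have l0 : 0 <= ln k.+2%:R :> R by apply: ln_ge0; rewrite ler1n.
have lk : ln k.+2%:R <= ln N.+2%:R :> R.
  by rewrite ler_ln ?posrE// ler_nat !ltnS ltnW.
have s1 : 1 <= Num.sqrt k.+2%:R :> R by rewrite -[leLHS]sqrtr1 ler_wsqrtr// ler1n.
apply: ler_pM; rewrite ?mulr_ge0 ?invr_ge0//.
  rewrite normrN -[leRHS]mul1r; apply: ler_pM => //; first exact: sin_max.
  by apply: le_trans (ler_normB _ _) _; rewrite (ger0_norm l0) lerD.
rewrite (ger0_norm (sqrtr_ge0 _)).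
by apply: ler_piMr => //; rewrite invf_le1// (lt_le_trans ltr01).
Qed.

Lemma l1norm_cvg : l1norm a @[a --> (0 : 'rV[R]_N)] --> (0 : R).
Proof.
have -> : (0 : R) = \sum_(k < N) `|(0 : 'rV[R]_N) 0 k|.
  by rewrite big1// => k _; rewrite mxE normr0.
apply: cvg_big => [||k _]; [exact: add_continuous|exact: nbhs_filter|].
by apply: cvg_norm; [exact: nbhs_filter|exact: coord_continuous].
Qed.

Lemma l1norm_sq_le a : l1norm a ^+ 2 <= N%:R ^+ 2 * sqnorm a.
Proof.
have q0 : 0 <= sqnorm a by apply: sumr_ge0 => k _; exact: sqr_ge0.
rewrite -[sqnorm a]sqr_sqrtr// -exprMn lerXn2r ?nnegrE ?mulr_ge0 ?sqrtr_ge0//.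
  by apply: sumr_ge0.
have -> : N%:R * Num.sqrt (sqnorm a) = \sum_(k < N) Num.sqrt (sqnorm a).
  by rewrite sumr_const card_ord mulr_natl.
apply: ler_sum => k _; rewrite -sqrtr_sqr ler_wsqrtr//.
rewrite /sqnorm (bigD1 k)//= lerDl; apply: sumr_ge0 => j _; exact: sqr_ge0.
Qed.

End DirichletTerms.
End NearGramPoint.

Theorem theorem2 (R : realType) (n : int) (g : R) (hg : gram_point n g) :
  (@gram_discriminant R g : 'rV[R]_(gramN g) -> R^o) =
    (fun a => Zsec g a) +O_ (nbhs (0 : 'rV[R]_(gramN g))) (fun a => sqnorm a : R^o).
Proof.
pose c : R := `|dtheta g|; pose N := gramN g.
have c0 : 0 < c by rewrite normr_gt0; exact: gram_point_dtheta_neq0 hg.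
have c20 : 0 < c ^+ 2 by rewrite exprn_gt0.
pose B : R := 3 / 2 * c + ln N.+2%:R.
have B0 : 0 <= B.
  by rewrite addr_ge0 ?mulr_ge0 ?ln_ge0 ?ler1n// ltW.
have kappa0 : 0 < c ^+ 2 / 32 by rewrite divr_gt0.
have mu0 : 0 < c ^+ 2 / 8 by rewrite divr_gt0.
have K0 : 0 <= 9 / 8 * c ^+ 2 by rewrite mulr_ge0// ltW.
have f0d t : is_derive t (1 : R) (fun s => cos (theta s)) (- sin (theta t) * dtheta t).
  exact: is_derive_cos_comp (is_derive_theta t).
have amp_ge0 (a : 'rV[R]_N) : 0 <= l1norm a by exact: sumr_ge0.
have amp0 : l1norm (0 : 'rV[R]_N) = 0.
  by rewrite /l1norm big1// => k _; rewrite mxE normr0.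
have [gamma0 gammac gammae] : is_extremal_branch (@extremal_branch R g).
  have [gamma [h1 h2 h3]] := exists_extremal_branch (gram_radius_gt0 hg) (gram_sign hg)
    kappa0 B0 f0d (@is_derive_Zpert R N) (cos_theta_extremum hg) (@dZpert_le R g N)
    amp0 amp_ge0 (@l1norm_cvg R N).
  by apply: (@getI _ _ gamma); split.
have val := branch_value_quadratic (gram_radius_gt0 hg) K0 mu0 B0 f0d
  (@is_derive_Zpert R N) (cos_theta_quadratic hg) (dcos_theta_ge hg) (@dZpert_le R g N)
  amp_ge0 gamma0 gammac gammae.
apply/eqaddOP/bigO_exP.
exists ((9 / 8 * c ^+ 2 * (B / (c ^+ 2 / 8)) ^+ 2 + B * (B / (c ^+ 2 / 8)))
  * N%:R ^+ 2 + 1).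
  (* The summand 1 makes the constant positive also when N = 0. *)
  by rewrite ltr_wpDl// mulr_ge0// addr_ge0// mulr_ge0// ?sqr_ge0// divr_ge0// ltW.
apply: filterS val => a ha.
apply: le_trans ha _.
have q0 : 0 <= sqnorm a by apply: sumr_ge0 => k _; exact: sqr_ge0.
set X := (X in X * N%:R ^+ 2 + 1).
have X0 : 0 <= X.
  by rewrite /X addr_ge0// mulr_ge0// ?sqr_ge0// divr_ge0// ltW.
apply: le_trans (ler_wpM2l X0 (l1norm_sq_le a)) _.
by rewrite (ger0_norm q0) [leRHS]mulrDl mul1r mulrA lerDl.
Qed.
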